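(* Under the stochastic setting below (unidirectional compression with deterministic $\delta$-contractive worker compressors), let $\beta\in(0,\tfrac12)$ and $R\ge\|x^0-x^*\|$. There exist an absolute constant $\kappa>0$, a stepsize $\gamma$, a threshold $c$ and a batch size $N_{\rm fv}$ of order $\frac{\sigma_{\rm fv}^2}{nc^2}$ up to logarithmic factors, such that with probability at least $1-2\beta$ $$f(\overline x^T)-f(x^* )\le\kappa\frac{\big(MR+\sigma_{\rm fv}/\sqrt{N_{\rm fv}}\big)\big(1+\log\frac1\beta\big)}{\sqrt{\delta T}},\qquad g(\overline x^T)\le\kappa\frac{\big(MR+\sigma_{\rm fv}/\sqrt{N_{\rm fv}}\big)\big(1+\log\frac1\beta\big)}{\sqrt{\delta T}}.$$
   Context: Problem: minimize $f=\frac1n\sum_if_i$ subject to $g=\frac1n\sum_ig_i\le0$ with optimal solution $x^*$, where $f_i(x)=\mathbb E_{\xi\sim\mathcal D_i}[f_i(x,\xi)]$, $g_i(x)=\mathbb E_{\xi\sim\mathcal D_i}[g_i(x,\xi)]$, and $f_i(\cdot,\xi),g_i(\cdot,\xi)$ are convex for every $\xi$. Worker $i$ can obtain stochastic subgradients $f_i'(x,\xi)\in\partial f_i(x,\xi)$, $g_i'(x,\xi)\in\partial g_i(x,\xi)$ with $\|f_i'(x,\xi)\|,\|g_i'(x,\xi)\|\le M$ and with means $\mathbb E_\xi f_i'(x,\xi)\in\partial f_i(x)$, $\mathbb E_\xi g_i'(x,\xi)\in\partial g_i(x)$, and stochastic constraint values $\hat g_i(x)$ (mini-batch of size $N_{\rm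 fv}$) with mean $g_i(x)$ satisfying $\mathbb E\exp\big((\hat g_i(x)-g_i(x))^2/(\sigma_{\rm fv}^2/N_{\rm fv})\big)\le e$; all samples are independent across workers, iterations, and between subgradient and function-value queries. Worker compressors $\mathcal C_i$ are deterministic maps with $\|\mathcal C_i(x)-x\|^2\le(1-\delta)\|x\|^2$ for all $x$, $\delta\in(0,1]$. Stochastic Safe-EF (unidirectional): given $x^0$, $\gamma,c>0$, $e_i^0=0$; for $t=0,\dots,T-1$: $\hat g^t=\frac1n\sum_i\hat g_i(x^t)$; $h_i^t=f_i'(x^t,\xi_i^t)$ if $\hat g^t\le c$, else $h_i^t=g_i'(x^t,\xi_i^t)$; $v_i^t=\mathcal C_i(e_i^t+h_i^t)$; $e_i^{t+1}=e_i^t+h_i^t-v_i^t$; $x^{t+1}=x^t-\frac\gamma n\sum_iv_i^t$. $\mathcal B=\{t\in\{0,\dots,T-1\}:\hat g^t\le c\}$, $\overline x^T=\frac1{|\mathcal B|}\sum_{t\in\mathcal B}x^t$. *)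

(* Defs.v *)
From HB Require Import structures.
From mathcomp Require Import all_boot all_order all_algebra.
From mathcomp Require Import all_classical all_reals all_analysis.

Set Implicit Arguments.
Unset Strict Implicit.
Unset Printing Implicit Defensive.

Import Order.TTheory GRing.Theory Num.Theory.
Import numFieldNormedType.Exports.

Local Open Scope classical_set_scope.
Local Open Scope ring_scope.

Section SafeEF.
Variable R : realType.

Definition dotv (d : nat) (u v : 'rV[R]_d) : R := \sum_(j < d) u ord0 j * v ord0 j.
Definition enorm (d : nat) (v : 'rV[R]_d) : R := Num.sqrt (dotv v v).

Definition is_subgrad (d : nat) (h : 'rV[R]_d -> R) (x v : 'rV[R]_d) : Prop :=
  forall y, h x + dotv v (y - x) <= h y.

Definition convex_fun (d : nat) (h : 'rV[R]_d -> R) : Prop :=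
  forall (x y : 'rV[R]_d) (l : R), 0 <= l <= 1 ->
    h (l *: x + (1 - l) *: y) <= l * h x + (1 - l) * h y.

Definition contractive (d : nat) (delta : R) (C : 'rV[R]_d -> 'rV[R]_d) : Prop :=
  forall x, enorm (C x - x) ^+ 2 <= (1 - delta) * enorm x ^+ 2.

(* ---------- Borel (product) sigma-algebra on R^d: generated by the coordinates ---------- *)
Definition vcoord (d : nat) (j : 'I_d) (v : 'rV[R]_d) : R := v ord0 j.
Definition vec_sets (d : nat) : set (set 'rV[R]_d) :=
  fun S => exists (j : 'I_d) (A : set R),
             measurable A /\ S = vcoord j @^-1` A.
Definition VecM (d : nat) := g_sigma_algebraType (@vec_sets d).

Definition mutually_independent (dO dX : measure_display)
  (O : measurableType dO) (X : measurableType dX) (I : eqType)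
  (P : probability O R) (Y : I -> O -> X) : Prop :=
  forall (s : seq I) (A : I -> set X), uniq s -> (forall i, measurable (A i)) ->
    P (\bigcap_(i in [set j | j \in s]) (Y i @^-1` A i))
    = (\prod_(i <- s) P (Y i @^-1` A i))%E.

(* ---------- Stochastic Safe-EF (unidirectional), for a fixed outcome ----------
   ghat t x    : the averaged stochastic constraint value (1/n) sum_i ghat_i(x)
                 observed at iteration t at query point x;
   fo t i x    : the stochastic subgradient f_i'(x, xi_i^t);
   go t i x    : the stochastic subgradient g_i'(x, xi_i^t).
   The state is (x^t, (e_i^t)_i). *)
Fixpoint safe_ef_state (d n : nat) (gamma c : R) (x0 : 'rV[R]_d)
  (C : 'I_n -> 'rV[R]_d -> 'rV[R]_d)
  (ghat : nat -> 'rV[R]_d -> R)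
  (fo go : nat -> 'I_n -> 'rV[R]_d -> 'rV[R]_d) (t : nat)
  : 'rV[R]_d * ('I_n -> 'rV[R]_d) :=
  match t with
  | 0 => (x0, fun _ => 0)
  | t'.+1 =>
      let st := safe_ef_state gamma c x0 C ghat fo go t' in
      let x := st.1 in
      let e := st.2 in
      let h := fun i => if ghat t' x <= c then fo t' i x else go t' i x in
      let v := fun i => C i (e i + h i) in
      (x - (gamma / n%:R) *: \sum_(i < n) v i, fun i => e i + h i - v i)
  end.

Definition safe_ef_B (d n : nat) (gamma c : R) (x0 : 'rV[R]_d)
  (C : 'I_n -> 'rV[R]_d -> 'rV[R]_d) (ghat : nat -> 'rV[R]_d -> R)
  (fo go : nat -> 'I_n -> 'rV[R]_d -> 'rV[R]_d) (T : nat) : seq nat :=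
  [seq t <- iota 0 T | ghat t (safe_ef_state gamma c x0 C ghat fo go t).1 <= c].

Definition safe_ef_xbar (d n : nat) (gamma c : R) (x0 : 'rV[R]_d)
  (C : 'I_n -> 'rV[R]_d -> 'rV[R]_d) (ghat : nat -> 'rV[R]_d -> R)
  (fo go : nat -> 'I_n -> 'rV[R]_d -> 'rV[R]_d) (T : nat) : 'rV[R]_d :=
  let B := safe_ef_B gamma c x0 C ghat fo go T in
  (size B)%:R^-1 *: \sum_(t <- B) (safe_ef_state gamma c x0 C ghat fo go t).1.

Definition vmean (d : nat) (dX : measure_display) (X : measurableType dX)
  (D : probability X R) (u : X -> 'rV[R]_d) : 'rV[R]_d :=
  \row_(j < d) fine (\int[D]_xi ((u xi) ord0 j)%:E)%E.

Definition batch_value (d n : nat) (dX : measure_display) (X : measurableType dX)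
  (O : Type)
  (gs : 'I_n -> 'rV[R]_d -> X -> R) (zeta : nat -> 'I_n -> nat -> O -> X)
  (N t : nat) (i : 'I_n) (x : 'rV[R]_d) (w : O) : R :=
  (N%:R)^-1 * \sum_(k < N) gs i x (zeta t i k w).

End SafeEF.

(* Main.v *)
(* Write [xh] for the iterate corrected by the compression errors: it performs exact
   stochastic subgradient steps, and the errors are at most [2 M / delta] by contraction.
   Noise is controlled through exponential supermartingales, whose one-step bound follows from
   the inequality [exp z <= z + exp (2 z^2)] after freezing the past.

   The difficulty is that the iterates are not bounded: [f (x^t) < f (xstar)] may hold for long
   times at slightly infeasible points, so the distance to [xstar] may grow. Two potentials
   are combined. First, the squared distance of [xh] to the set where [f <= f xstar] and
   [g <= c + eps]: along it no step is substantially lossy, whence the sum of the positive parts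
   of [f (x^t) - f xstar] over the steps in B is of order [R^2 (1 + ln (1/beta)) / gamma].
   Second, the squared distance to [xstar], stopped when it first exceeds a large multiple of
   [R^2 (1 + ln (1/beta))]. If this never happens, the usual analysis applies. If it
   happens, the gaps accumulated before that time are so negative that they outweigh all the
   positive parts, and [f (xbar) < f xstar] by convexity. *)

Require Import Defs.
From HB Require Import structures.
From mathcomp Require Import all_boot all_order all_algebra.
From mathcomp Require Import all_classical all_reals all_analysis.
From mathcomp Require Import measurable_realfun.
From mathcomp Require Import ring lra.
Set Implicit Arguments.
Unset Strict Implicit.
Unset Printing Implicit Defensive.
Import Order.TTheory GRing.Theory Num.Theory.
Import numFieldNormedType.Exports.
Local Open Scope classical_set_scope.
Local Open Scope ring_scope.

(** * The Euclidean norm *)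

(** The errors of size [M / delta] cost only one factor [1 / delta]. In the drift they meet a step
    of length [gamma * M], which gives [gamma ^+ 2 * M ^+ 2 / delta]; in the noise they are squared
    but weighted by [gamma ^+ 2 * M ^+ 2], which compensates. The stepsize makes the total of these
    costs over [T] steps equal to [Rad ^+ 2]. The obstacle is circular: the variance of the noise in
    a squared distance is proportional to that squared distance, so bounding the distance needs
    control of the noise and conversely. For the first potential the variance is absorbed by slowly
    decreasing weights; for the second it is bounded by stopping. Both allow exponents of order
    [1 / Rad ^+ 2] only, hence a logarithm of [1 / beta] to the first power. The stopping level
    fixes the constants: in the exponent of the second potential, noise and failure probability use
    about [65 * l], whereas reaching the level is worth [80 * l]. The difference has to beat the
    positive parts. *)

Section Euclidean.
Context {R : realType} {d : nat}.
Implicit Types u v w : 'rV[R]_d.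

Lemma dotvC u v : dotv u v = dotv v u.
Proof. by apply: eq_bigr => j _; rewrite mulrC. Qed.

Lemma dotvDl u v w : dotv (u + v) w = dotv u w + dotv v w.
Proof. by rewrite -big_split; apply: eq_bigr => j _; rewrite mxE mulrDl. Qed.

Lemma dotvZl k u v : dotv (k *: u) v = k * dotv u v.
Proof. by rewrite mulr_sumr; apply: eq_bigr => j _; rewrite mxE mulrA. Qed.

Lemma dotvDr u v w : dotv u (v + w) = dotv u v + dotv u w.
Proof. by rewrite dotvC dotvDl !(dotvC u). Qed.

Lemma dotvZr k u v : dotv u (k *: v) = k * dotv u v.
Proof. by rewrite dotvC dotvZl dotvC. Qed.

Lemma dotvNl u v : dotv (- u) v = - dotv u v.
Proof. by rewrite -scaleN1r dotvZl mulN1r. Qed.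

Lemma dotvNr u v : dotv u (- v) = - dotv u v.
Proof. by rewrite dotvC dotvNl dotvC. Qed.

Lemma dotvBr u v w : dotv u (v - w) = dotv u v - dotv u w.
Proof. by rewrite dotvDr dotvNr. Qed.

Lemma dotvBl u v w : dotv (u - v) w = dotv u w - dotv v w.
Proof. by rewrite dotvDl dotvNl. Qed.

Lemma dotv0l v : dotv 0 v = 0.
Proof. by rewrite -(scale0r 0) dotvZl mul0r. Qed.

Lemma dotv0r v : dotv v 0 = 0.
Proof. by rewrite dotvC dotv0l. Qed.

Lemma dotv_suml (I : Type) (r : seq I) (F : I -> 'rV[R]_d) v :
  dotv (\sum_(i <- r) F i) v = \sum_(i <- r) dotv (F i) v.
Proof.
elim: r => [|i r IH]; first by rewrite !big_nil dotv0l.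
by rewrite !big_cons dotvDl IH.
Qed.

Lemma dotv_ge0 v : 0 <= dotv v v.
Proof. by apply: sumr_ge0 => j _; rewrite -expr2 sqr_ge0. Qed.

Lemma enorm_ge0 v : 0 <= enorm v.
Proof. exact: sqrtr_ge0. Qed.

Lemma enorm_sqr v : enorm v ^+ 2 = dotv v v.
Proof. by rewrite sqr_sqrtr// dotv_ge0. Qed.

Lemma enormN v : enorm (- v) = enorm v.
Proof. by rewrite /enorm dotvNl dotvNr opprK. Qed.

Lemma enormC u v : enorm (u - v) = enorm (v - u).
Proof. by rewrite -enormN opprB. Qed.

Lemma enorm0 : enorm (0 : 'rV[R]_d) = 0.
Proof. by rewrite /enorm dotv0l sqrtr0. Qed.

Lemma enormZ k v : enorm (k *: v) = `|k| * enorm v.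
Proof.
by rewrite /enorm dotvZl dotvZr mulrA -expr2 sqrtrM ?sqr_ge0// sqrtr_sqr.
Qed.

Lemma dotv_le_enorm u v : dotv u v <= enorm u * enorm v.
Proof.
have [u0|u0] := eqVneq (enorm u) 0.
  have /eqP uu0 : dotv u u == 0 by rewrite -enorm_sqr u0 expr0n.
  suff -> : u = 0 by rewrite dotv0l enorm0 mul0r.
  apply/rowP => j; rewrite mxE; apply/eqP; rewrite -sqrf_eq0 expr2.
  move/eqP: uu0; rewrite /dotv psumr_eq0 => [/allP/(_ j)|i _]; last first.
    by rewrite -expr2 sqr_ge0.
  by rewrite mem_index_enum /= => /(_ isT).
have un : 0 < enorm u by rewrite lt_neqAle eq_sym u0 enorm_ge0.
have := dotv_ge0 (enorm u *: v - enorm v *: u).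
rewrite dotvBl !dotvBr !dotvZl !dotvZr -!enorm_sqr (dotvC v u) => h.
have {}h : 2 * (enorm u * enorm v) * dotv u v <=
           2 * (enorm u * enorm v) * (enorm u * enorm v).
  by move: h; nra.
have [v0|v0] := eqVneq (enorm v) 0.
  rewrite v0 mulr0.
  have /eqP uu0 : dotv v v == 0 by rewrite -enorm_sqr v0 expr0n.
  suff -> : v = 0 by rewrite dotv0r.
  apply/rowP => j; rewrite mxE; apply/eqP; rewrite -sqrf_eq0 expr2.
  move/eqP: uu0; rewrite /dotv psumr_eq0 => [/allP/(_ j)|i _]; last first.
    by rewrite -expr2 sqr_ge0.
  by rewrite mem_index_enum /= => /(_ isT).
have vn : 0 < enorm v by rewrite lt_neqAle eq_sym v0 enorm_ge0.
by rewrite ler_pM2l// in h; rewrite !mulr_gt0.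
Qed.

Lemma normr_dotv u v : `|dotv u v| <= enorm u * enorm v.
Proof.
rewrite ler_norml dotv_le_enorm andbT lerNl -dotvNl -(enormN u).
exact: dotv_le_enorm.
Qed.

Lemma enorm_sqrB u v :
  enorm (u - v) ^+ 2 = enorm u ^+ 2 - 2 * dotv u v + enorm v ^+ 2.
Proof. by rewrite !enorm_sqr dotvBl !dotvBr (dotvC v u); ring. Qed.

Lemma ler_enormD u v : enorm (u + v) <= enorm u + enorm v.
Proof.
rewrite -(@ler_pXn2r _ 2)// ?nnegrE ?enorm_ge0 ?addr_ge0 ?enorm_ge0//.
rewrite -{1}(opprK v) enorm_sqrB dotvNr enormN.
have := dotv_le_enorm u v; nra.
Qed.

Lemma ler_enormB u v w : enorm (u - w) <= enorm (u - v) + enorm (v - w).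
Proof. by apply: le_trans (ler_enormD _ _); rewrite addrA subrK. Qed.

Lemma ler_enorm_sum (I : Type) (r : seq I) (F : I -> 'rV[R]_d) :
  enorm (\sum_(i <- r) F i) <= \sum_(i <- r) enorm (F i).
Proof.
elim: r => [|i r IH]; first by rewrite !big_nil enorm0.
by rewrite !big_cons (le_trans (ler_enormD _ _))// lerD2l.
Qed.

Lemma enorm_sqrD_le u v :
  enorm (u + v) ^+ 2 <= 2 * enorm u ^+ 2 + 2 * enorm v ^+ 2.
Proof.
have := ler_enormD u v; have := enorm_ge0 (u + v).
have := sqr_ge0 (enorm u - enorm v); nra.
Qed.

Lemma enorm_avg_le (n : nat) (F : 'I_n -> 'rV[R]_d) (b : R) : (0 < n)%N ->
  (forall i, enorm (F i) <= b) -> enorm (n%:R^-1 *: \sum_i F i) <= b.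
Proof.
move=> n0 Fb; have nR : (0 : R) < n%:R by rewrite ltr0n.
rewrite enormZ ger0_norm ?invr_ge0 ?ler0n// mulrC ler_pdivrMr//.
apply: (le_trans (ler_enorm_sum _ _)).
apply: (@le_trans _ _ (\sum_(i < n) b)); first exact: ler_sum.
by rewrite sumr_const card_ord mulr_natr.
Qed.

Lemma coord_le_enorm v j : `|v ord0 j| <= enorm v.
Proof.
rewrite -sqrtr_sqr ler_wsqrtr// /dotv (bigD1 j)//= -expr2 lerDl.
by apply: sumr_ge0 => i _; rewrite -expr2 sqr_ge0.
Qed.

Lemma enorm_le_sum v : enorm v <= \sum_j `|v ord0 j|.
Proof.
rewrite -(@ler_pXn2r _ 2)// ?nnegrE ?enorm_ge0 ?sumr_ge0// enorm_sqr.
rewrite expr2 mulr_suml; apply: ler_sum => j _.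
apply: le_trans (ler_norm _) _; rewrite normrM ler_wpM2l//.
by rewrite (bigD1 j)//= lerDl sumr_ge0.
Qed.

End Euclidean.

(** For a centred variable the linear term integrates to zero and only [expR (2 * z ^+ 2)] remains.
    Up to [1 / 2] one compares with [(1 - z)^-1]; beyond, [z <= 2 * z ^+ 2]. *)
Lemma expR_le_subgauss {R : realType} (z : R) : expR z <= z + expR (2 * z ^+ 2).
Proof.
have [z0|z0] := leP z 0.
  have h : expR z <= (1 - z)^-1.
    rewrite -[z in leLHS]opprK expRN lef_pV2 ?posrE ?expR_gt0//; last lra.
    by have := expR_ge1Dx (- z); lra.
  have h2 := expR_ge1Dx (2 * z ^+ 2).
  have h3 : (1 - z)^-1 <= 1 + z + z ^+ 2.
    rewrite -[leLHS]div1r ler_pdivrMr; first by nra.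
    lra.
  by have := sqr_ge0 z; lra.
have [z1|z1] := leP z (2^-1).
  have h : expR z <= (1 - z)^-1.
    rewrite -[z in leLHS]opprK expRN lef_pV2 ?posrE ?expR_gt0//; last lra.
    have := expR_ge1Dx (- z); lra.
  have h2 := expR_ge1Dx (2 * z ^+ 2).
  have h3 : (1 - z)^-1 <= 1 + z + 2 * z ^+ 2.
    rewrite -[leLHS]div1r ler_pdivrMr; last lra.
    have -> : (1 + z + 2 * z ^+ 2) * (1 - z) = 1 + z ^+ 2 * (1 - 2 * z) by ring.
    by rewrite lerDl mulr_ge0 ?sqr_ge0//; lra.
  by lra.
have : expR z <= expR (2 * z ^+ 2) by rewrite ler_expR; nra.
lra.
Qed.

(** * Measurability of vector-valued functions *)

Section VecMeasurability.
Context {R : realType} {d : nat} {dT : measure_display} {T : measurableType dT}.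
Implicit Types f g : T -> VecM R d.

Lemma measurable_vcoord (j : 'I_d) : measurable_fun setT (fun v : VecM R d => v ord0 j).
Proof.
move=> _ A mA; rewrite setTI; apply: sub_sigma_algebra.
by exists j, A; split.
Qed.

Lemma measurable_vecP f :
  (forall j, measurable_fun setT (fun w => f w ord0 j)) -> measurable_fun setT f.
Proof.
move=> mf; apply: (@measurability _ _ T (VecM R d) setT f (@vec_sets R d)) => //.
move=> _ [_ [j [A [mA ->]]] <-]; rewrite setTI.
by rewrite -[X in measurable X]setTI; exact: mf.
Qed.

Lemma measurable_coord f j :
  measurable_fun setT f -> measurable_fun setT (fun w => f w ord0 j).
Proof. by move=> mf; exact: (measurableT_comp (measurable_vcoord j)). Qed.

Lemma measurable_vecD f g : measurable_fun setT f -> measurable_fun setT g ->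
  measurable_fun setT (fun w => f w + g w : VecM R d).
Proof.
move=> mf mg; apply: measurable_vecP => j.
under eq_fun do rewrite mxE.
by apply: measurable_funD; exact: measurable_coord.
Qed.

Lemma measurable_vecZ (k : R) f : measurable_fun setT f ->
  measurable_fun setT (fun w => k *: f w : VecM R d).
Proof.
move=> mf; apply: measurable_vecP => j.
under eq_fun do rewrite mxE.
by apply: measurable_funM => //; exact: measurable_coord.
Qed.

Lemma measurable_vecB f g : measurable_fun setT f -> measurable_fun setT g ->
  measurable_fun setT (fun w => f w - g w : VecM R d).
Proof.
move=> mf mg; under eq_fun do rewrite -scaleN1r.
by apply: measurable_vecD => //; exact: measurable_vecZ.
Qed.

Lemma measurable_vec_sum (I : Type) (r : seq I) (F : I -> T -> VecM R d) :
  (forall i, measurable_fun setT (F i)) ->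
  measurable_fun setT (fun w => \sum_(i <- r) F i w : VecM R d).
Proof.
move=> mF; elim: r => [|i r IH].
  by under eq_fun do rewrite big_nil; exact: measurable_cst.
by under eq_fun do rewrite big_cons; exact: measurable_vecD.
Qed.

Lemma measurable_dotv f g : measurable_fun setT f -> measurable_fun setT g ->
  measurable_fun setT (fun w => dotv (f w) (g w)).
Proof.
move=> mf mg; apply: measurable_sum => j.
by apply: measurable_funM; exact: measurable_coord.
Qed.

End VecMeasurability.

Lemma rat_vec_dense {R : realType} {d : nat} (x : 'rV[R]_d) (eta : R) : 0 < eta ->
  exists q : 'rV[rat]_d, enorm (x - map_mx ratr q) < eta.
Proof.
move=> eta0.
have dp : (0 : R) < d.+1%:R by rewrite ltr0n.
(* Dividing by [d.+1] makes the final inequality strict and covers [d = 0]. *)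
have e0 : 0 < eta / d.+1%:R by rewrite divr_gt0.
have H j : exists q : rat, `|x ord0 j - ratr q| <= eta / d.+1%:R.
  set e := eta / _ in e0 *; set y := x ord0 j.
  have lte : y - e < y + e by lra.
  have [q] := rat_in_itvoo lte.
  rewrite in_itv /= => /andP[h1 h2]; exists q.
  by rewrite ler_norml; apply/andP; split; lra.
have [q qP] := choice H.
exists (\row_j q j); apply: le_lt_trans (enorm_le_sum _) _.
apply: (@le_lt_trans _ _ (\sum_(j < d) (eta / d.+1%:R))).
  by apply: ler_sum => j _; rewrite !mxE; exact: qP.
rewrite sumr_const card_ord -[X in X < _]mulr_natr mulrAC ltr_pdivrMr// ltr_pM2l//.
by rewrite ltr_nat.
Qed.

(* A Lipschitz function is the infimum of countably many translated norms. *)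
Lemma measurable_lipschitz {R : realType} {d : nat} (h : 'rV[R]_d -> R) (L : R) :
  0 <= L -> (forall x y, h x <= h y + L * enorm (x - y)) ->
  measurable_fun setT (h : VecM R d -> R).
Proof.
move=> L0 hL; apply: (measurability (@RGenInftyO.G R)).
  exact: RGenInftyO.measurableE.
move=> _ [_ [b ->] <-]; rewrite setTI.
have mq (q : 'rV[rat]_d) : measurable ([set x : VecM R d |
    h (map_mx ratr q) + L * enorm (x - map_mx ratr q) < b]).
  rewrite -[X in measurable X]setTI.
  have : measurable_fun setT (fun x : VecM R d =>
      h (map_mx ratr q) + L * Num.sqrt (dotv (x - map_mx ratr q) (x - map_mx ratr q))).
    apply: measurable_funD => //; apply: measurable_funM => //.
    have mB : measurable_fun setT (fun x : VecM R d => x - map_mx ratr q : VecM R d).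
      exact: measurable_vecB.
    by apply: measurableT_comp; [exact: (continuous_measurable_fun (@sqrt_continuous R))|exact: measurable_dotv].
  move=> /(_ measurableT `]-oo, b[%classic (measurable_itv _)).
  by congr measurable; apply/seteqP; split => x /=; rewrite in_itv/=.
rewrite (_ : _ @^-1` _ = \bigcup_(q : 'rV[rat]_d) [set x : VecM R d |
    h (map_mx ratr q) + L * enorm (x - map_mx ratr q) < b]).
  apply: countable_bigcupT_measurable; [exact: countableP|exact: mq].
apply/seteqP; split => [x /=|x [q _] /=]; rewrite in_itv/=; last first.
  exact: le_lt_trans.
move=> hb.
(* Moving to [q] and back costs [2 * L] times the distance, hence this radius; the added 1 covers
   [L = 0]. *)
have [q hq] := @rat_vec_dense R d x ((b - h x) / (2 * L + 1)) ltac:(by rewrite divr_gt0//; lra).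
exists q => //=.
rewrite ltr_pdivlMr in hq; last lra.
have := hL (map_mx ratr q) x; rewrite enormC.
have := enorm_ge0 (x - map_mx ratr q); nra.
Qed.

(** * Independent blocks of samples *)

Lemma bigcap_mem_nil {T : Type} {I : eqType} (F : I -> set T) :
  \bigcap_(i in [set j | j \in [::]]) F i = setT.
Proof. by apply/seteqP; split. Qed.

Lemma bigcap_mem_cons {T : Type} {I : eqType} (i0 : I) (s : seq I) (F : I -> set T) :
  \bigcap_(i in [set j | j \in i0 :: s]) F i =
  F i0 `&` \bigcap_(i in [set j | j \in s]) F i.
Proof.
apply/seteqP; split => w /=.
  by move=> h; split => [|i is_]; apply: h; rewrite /= inE ?eqxx ?is_ ?orbT.
by move=> [h0 h] i /=; rewrite inE => /predU1P[->//|]; exact: h.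
Qed.

Section Independence.
Context {R : realType} {dO dX : measure_display} {O : measurableType dO}
  {X : measurableType dX} {I : eqType}.
Variables (P : probability O R) (Y : I -> O -> X).
Hypothesis mY : forall i, measurable_fun setT (Y i).

(** Finite cylinders over the samples indexed by [Q]. They form a pi-system, so uniqueness of
    measures applies to the sigma-algebra [Hist Q] that they generate on the same carrier [O]. *)
Definition hist_sets (Q : set I) : set (set O) := fun S =>
  exists (s : seq I) (A : I -> set X), [/\ uniq s, forall i, i \in s -> Q i,
    forall i, measurable (A i) &
    S = \bigcap_(i in [set j | j \in s]) (Y i @^-1` A i)].

Definition Hist (Q : set I) := g_sigma_algebraType (hist_sets Q).

Let mpre i (A : set X) : measurable A -> measurable (Y i @^-1` A).
Proof. by move=> mA; rewrite -[X in measurable X]setTI; exact: mY. Qed.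

Lemma hist_sets_measurable Q : hist_sets Q `<=` @measurable _ O.
Proof.
move=> _ [s [A [_ _ mA ->]]].
elim: s => [|i s IH]; first by rewrite bigcap_mem_nil.
by rewrite bigcap_mem_cons; apply: measurableI => //; exact: mpre.
Qed.

Lemma Hist_measurable Q (S : set O) :
  @measurable _ (Hist Q) S -> @measurable _ O S.
Proof. by apply: smallest_sub; [exact: sigma_algebra_measurable|exact: hist_sets_measurable]. Qed.

Lemma hist_setsT Q : hist_sets Q setT.
Proof.
exists [::], (fun=> setT); split => //.
by rewrite bigcap_mem_nil.
Qed.

Lemma hist_setsI Q : setI_closed (hist_sets Q).
Proof.
move=> _ _ [s [A [us sQ mA ->]]] [t [B [ut tQ mB ->]]].
exists (undup (s ++ t)), (fun i => (if i \in s then A i else setT) `&`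
  (if i \in t then B i else setT)); split.
- exact: undup_uniq.
- by move=> i; rewrite mem_undup mem_cat => /orP[/sQ|/tQ].
- by move=> i; apply: measurableI; case: ifP.
- apply/seteqP; split => w /=.
    move=> [hs ht] i /=; rewrite mem_undup mem_cat => _.
    by split; case: ifP => // h; [exact: hs|exact: ht].
  move=> h; split => i /= iin; have := h i; rewrite /= mem_undup mem_cat iin ?orbT.
    by move=> /(_ isT)[].
  by move=> /(_ isT)[].
Qed.

Lemma HistS Q Q' d' (Z : measurableType d') (f : O -> Z) : Q `<=` Q' ->
  measurable_fun setT (f : Hist Q -> Z) -> measurable_fun setT (f : Hist Q' -> Z).
Proof.
move=> QQ' mf _ A mA; have := mf measurableT A mA.
suff sub : @measurable _ (Hist Q) `<=` @measurable _ (Hist Q') by exact: sub.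
apply: smallest_sub; first exact: sigma_algebra_measurable.
move=> _ [s [B [us sQ mB ->]]]; apply: sub_sigma_algebra.
by exists s, B; split => // i /sQ /QQ'.
Qed.

Lemma Hist_measurable_fun Q d' (Z : measurableType d') (f : O -> Z) :
  measurable_fun setT (f : Hist Q -> Z) -> measurable_fun setT f.
Proof. by move=> mf _ A mA; apply: (@Hist_measurable Q); exact: mf. Qed.

Lemma Hist_sample Q i : Q i -> measurable_fun setT (Y i : Hist Q -> X).
Proof.
move=> Qi _ A mA; rewrite setTI; apply: sub_sigma_algebra.
exists [:: i], (fun=> A); split => //; first by move=> j; rewrite inE => /eqP ->.
by rewrite bigcap_mem_cons bigcap_mem_nil setIT.
Qed.

Hypothesis indepY : mutually_independent P Y.

Lemma hist_sets_indep Q1 Q2 S1 S2 : (forall i, Q1 i -> ~ Q2 i) ->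
  hist_sets Q1 S1 -> hist_sets Q2 S2 -> P (S1 `&` S2) = (P S1 * P S2)%E.
Proof.
move=> Q12 [s [A [us sQ mA ->]]] [t [B [ut tQ mB ->]]].
pose C i := if i \in s then A i else B i.
have mC i : measurable (C i) by rewrite /C; case: ifP.
have st i : i \in t -> (i \in s) = false.
  by move=> it; apply/negP => /sQ /Q12; apply; exact: tQ.
have ust : uniq (s ++ t).
  rewrite cat_uniq us ut andbT /=; apply/hasPn => i it /=.
  by rewrite (st i it).
rewrite (_ : _ `&` _ = \bigcap_(i in [set j | j \in s ++ t]) (Y i @^-1` C i)).
  rewrite !indepY// big_cat/=; congr (_ * _)%E; apply: eq_big_seq => i ii.
    by rewrite /C ii.
  by rewrite /C st.
apply/seteqP; split => w /=.
  move=> [hs ht] i /=; rewrite mem_cat /C; case: ifP => [ii _|ni /= ii].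
    exact: hs.
  exact: ht.
move=> h; split => i /= ii; have := h i; rewrite /= mem_cat ii ?orbT /C.
  by rewrite ii => /(_ isT).
by rewrite st// => /(_ isT).
Qed.

(** For fixed [S2], the restriction of [P] to [S2] and the multiple of [P] by [P S2] are finite
    measures that agree on a pi-system, hence on the generated sigma-algebra. Used on each side in
    turn, this makes two blocks independent. *)
Lemma indep_ext (Q : set I) (S2 : set O) : measurable S2 ->
  (forall S1, hist_sets Q S1 -> P (S1 `&` S2) = (P S1 * P S2)%E) ->
  forall S1, @measurable _ (Hist Q) S1 -> P (S1 `&` S2) = (P S1 * P S2)%E.
Proof.
move=> mS2 H S1 mS1.
have f2 : P S2 \is a fin_num by exact: fin_num_measure.
have n2 : 0 <= fine (P S2) by rewrite fine_ge0.
have : mrestr P mS2 S1 = mscale (NngNum n2) P S1; last first.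
  by rewrite /mrestr /mscale /= fineK// muleC => ->.
apply: (@g_sigma_algebra_measure_unique _ R O (hist_sets Q)
  (@hist_sets_measurable Q) (fun=> setT) (fun=> hist_setsT Q)) => //.
- by rewrite bigcup_const.
- exact: hist_setsI.
- move=> A hA; change (P (A `&` S2) = (fine (P S2))%:E * P A)%E; by rewrite fineK// muleC H.
- move=> _; change (P (setT `&` S2) < +oo)%E; rewrite setTI.
  exact: (le_lt_trans (probability_le1 P mS2)) (ltry _).
Qed.

Lemma Hist_indep Q1 Q2 S1 S2 : (forall i, Q1 i -> ~ Q2 i) ->
  @measurable _ (Hist Q1) S1 -> @measurable _ (Hist Q2) S2 ->
  P (S1 `&` S2) = (P S1 * P S2)%E.
Proof.
move=> Q12 m1 m2; apply: (@indep_ext Q1) => //; first exact: (@Hist_measurable Q2).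
move=> {m1}S1 h1; rewrite setIC muleC; apply: (@indep_ext Q2) => //.
  exact: (@hist_sets_measurable Q1).
by move=> S h2; rewrite setIC muleC; exact: (@hist_sets_indep Q1 Q2).
Qed.

(* Freezing: a function of independent blocks of samples may be integrated
   with respect to the second block first, the first one being fixed. *)
Lemma integral_freeze_le Q1 Q2 (psi : Hist Q1 * Hist Q2 -> \bar R) (V : O -> \bar R) :
  (forall i, Q1 i -> ~ Q2 i) -> measurable_fun setT psi -> (forall z, 0 <= psi z)%E ->
  measurable_fun setT (V : Hist Q1 -> \bar R) ->
  (forall w, \int[P]_w' psi (w, w') <= V w)%E ->
  (\int[P]_w psi (w, w) <= \int[P]_w V w)%E.
Proof.
move=> Q12 mpsi psi0 mV psiV.
have mid Q : measurable_fun setT (id : O -> Hist Q).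
  by move=> _ A mA; rewrite setTI preimage_id; exact: (@Hist_measurable Q).
have mdiag : measurable_fun setT (fun w : O => (w, w) : Hist Q1 * Hist Q2).
  by apply: measurable_fun_pair; exact: mid.
pose i1 : {mfun O >-> Hist Q1} := HB.pack (id : O -> Hist Q1) (isMeasurableFun.Build _ _ _ _ _ (mid Q1)).
pose i2 : {mfun O >-> Hist Q2} := HB.pack (id : O -> Hist Q2) (isMeasurableFun.Build _ _ _ _ _ (mid Q2)).
pose i12 : {mfun O >-> (Hist Q1 * Hist Q2)%type} :=
  HB.pack (fun w : O => (w, w) : Hist Q1 * Hist Q2) (isMeasurableFun.Build _ _ _ _ _ mdiag).
(* [i1] and [i2] are the identity into coarser sigma-algebras. Independence of the blocks says that
   the law of the diagonal map is the product of their laws, so Tonelli's theorem applies. *)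
have E : forall S, measurable S -> (distribution P i1 \x distribution P i2)%E S = distribution P i12 S.
  apply: product_measure_unique => A B mA mB.
  rewrite /distribution /pushforward /=.
  by rewrite -(Hist_indep Q12 mA mB); congr (P _); apply/seteqP; split.
have V0 w : (0 <= V w)%E by apply: le_trans (psiV w); exact: integral_ge0.
have mpsi2 w : measurable_fun setT (fun w' : Hist Q2 => psi (w, w')).
  exact: (measurableT_comp mpsi (pair1_measurable w)).
rewrite (_ : (\int[P]_w psi (w, w))%E = \int[distribution P i12]_z psi z)%E; last first.
  by rewrite ge0_integral_distribution.
rewrite (eq_measure_integral (distribution P i1 \x distribution P i2)%E); last first.
  by move=> A mA _; exact: (esym (E A mA)).
rewrite fubini_tonelli1//.
rewrite (_ : (\int[P]_w V w)%E = \int[distribution P i1]_w V w)%E; last first.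
  by rewrite ge0_integral_distribution.
apply: ge0_le_integral => //.
- by move=> w _; exact: integral_ge0.
- exact: measurable_fun_fubini_tonelli_F.
- move=> w _; apply: le_trans (psiV w).
  by rewrite /fubini_F ge0_integral_distribution.
Qed.
End Independence.

(** * Exponential moments *)

Lemma measurable_set_lt {R : realType} {dT : measure_display} {T : measurableType dT}
  (f : T -> R) (k : R) : measurable_fun setT f -> measurable [set w | k < f w].
Proof.
move=> mf; rewrite -[X in measurable X]setTI.
have mtrue : measurable [set true] by [].
have := measurable_fun_ltr (measurable_cst k) mf measurableT mtrue.
by congr (measurable (_ `&` _)); apply/seteqP; split.
Qed.

Section Means.
Context {R : realType} {dT : measure_display} {T : measurableType dT}.
Variable mu : probability T R.
Implicit Types f g : T -> R.

Definition has_mean f (m : R) : Prop :=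
  mu.-integrable setT (EFin \o f) /\ (\int[mu]_x (f x)%:E = m%:E)%E.

Lemma has_mean_cst (k : R) : has_mean (fun=> k) k.
Proof.
split; last by rewrite (integral_cst mu measurableT k%:E) /= probability_setT mule1.
by apply: finite_measure_integrable_cst.
Qed.

Lemma has_meanD f g m m' : has_mean f m -> has_mean g m' ->
  has_mean (fun x => f x + g x) (m + m').
Proof.
move=> [fi fm] [gi gm]; split; first exact: (integrableD measurableT fi gi).
by rewrite EFinD -fm -gm -(integralD_EFin measurableT fi gi).
Qed.

Lemma has_meanZ (k : R) f m : has_mean f m -> has_mean (fun x => k * f x) (k * m).
Proof.
move=> [fi fm]; split; first exact: (integrableZl measurableT k fi).
by rewrite EFinM -fm -(integralZl measurableT fi).
Qed.

Lemma has_mean_sum (I : Type) (r : seq I) (F : I -> T -> R) (m : I -> R) :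
  (forall i, has_mean (F i) (m i)) ->
  has_mean (fun x => \sum_(i <- r) F i x) (\sum_(i <- r) m i).
Proof.
move=> H; elim: r => [|i r IH].
  by rewrite big_nil; under eq_fun do rewrite big_nil; exact: has_mean_cst.
by rewrite big_cons; under eq_fun do rewrite big_cons; exact: has_meanD.
Qed.

Lemma has_mean_le f g m m' : has_mean f m -> has_mean g m' ->
  (forall x, f x <= g x) -> m <= m'.
Proof.
move=> [fi fm] [gi gm] fg; rewrite -lee_fin -fm -gm.
by apply: le_integral => // x _; rewrite lee_fin.
Qed.

Lemma integral_le_mean f g m : measurable_fun setT g -> has_mean f m ->
  (forall x, 0 <= g x <= f x) -> (\int[mu]_x (g x)%:E <= m%:E)%E.
Proof.
move=> mg [fi fm] gf; rewrite -fm; apply: ge0_le_integral => //.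
- by move=> x _; rewrite lee_fin; case/andP: (gf x).
- exact/measurable_EFinP.
- by case/integrableP: fi.
- by move=> x _; rewrite lee_fin; case/andP: (gf x).
Qed.

Lemma bounded_has_mean f (b : R) : measurable_fun setT f -> (forall x, `|f x| <= b) ->
  has_mean f (fine (\int[mu]_x (f x)%:E)%E).
Proof.
move=> mf fb.
have fi : mu.-integrable setT (EFin \o f).
  apply: measurable_bounded_integrable => //; first by rewrite /= probability_setT ltry.
  exists b; split; first by rewrite num_real.
  by move=> c bc x _; exact: le_trans (fb x) (ltW bc).
by split => //; rewrite fineK//; exact: integrable_fin_num.
Qed.

Lemma ge0_has_mean f (b : R) : measurable_fun setT f -> (forall x, 0 <= f x) ->
  (\int[mu]_x (f x)%:E <= b%:E)%E -> exists2 m, has_mean f m & m <= b.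
Proof.
move=> mf f0 fb.
have fi : mu.-integrable setT (EFin \o f).
  apply/integrableP; split; first exact/measurable_EFinP.
  rewrite (_ : (\int[mu]_x `|(EFin \o f) x|)%E = (\int[mu]_x (f x)%:E)%E).
    exact: le_lt_trans fb (ltry _).
  by apply: eq_integral => x _ /=; rewrite ger0_norm.
have ff := integrable_fin_num measurableT fi.
exists (fine (\int[mu]_x (f x)%:E)%E); first by split => //; rewrite fineK.
by rewrite -lee_fin fineK.
Qed.

Lemma vmean_dotv {d : nat} (s : T -> 'rV[R]_d) (b : R) (y : 'rV[R]_d) :
  (forall j, measurable_fun setT (fun x => s x ord0 j)) ->
  (forall x, enorm (s x) <= b) -> has_mean (fun x => dotv (s x) y) (dotv (vmean mu s) y).
Proof.
move=> ms sb; apply: has_mean_sum => j.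
rewrite mxE [_ * _ ord0 j]mulrC; under eq_fun do rewrite mulrC.
apply: has_meanZ; apply: (@bounded_has_mean _ b) => // x.
exact: le_trans (coord_le_enorm _ _) (sb x).
Qed.

(** Pairing the mean with itself gives [dotv v v <= b * enorm v]. *)
Lemma enorm_vmean_le {d : nat} (s : T -> 'rV[R]_d) (b : R) :
  (forall j, measurable_fun setT (fun x => s x ord0 j)) ->
  (forall x, enorm (s x) <= b) -> enorm (vmean mu s) <= b.
Proof.
move=> ms sb; set v := vmean mu s.
have b0 : 0 <= b := le_trans (enorm_ge0 _) (sb point).
have := has_mean_le (vmean_dotv v ms sb) (has_mean_cst (b * enorm v)).
move=> /(_ _) h; have {h} : dotv v v <= b * enorm v.
  apply: h => x; apply: le_trans (dotv_le_enorm _ _) _.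
  by rewrite ler_wpM2r ?enorm_ge0.
rewrite -enorm_sqr expr2; have [->//|v0] := eqVneq (enorm v) 0.
by rewrite ler_pM2r// lt_neqAle eq_sym v0 enorm_ge0.
Qed.

(** [expR_le_subgauss] is applied to [f - m], which is at most [2 * b] in absolute value; this is
    the origin of the 8. *)
Lemma hoeffding_mgf f (m b : R) : measurable_fun setT f -> has_mean f m ->
  (forall x, `|f x| <= b) ->
  (\int[mu]_x (expR (f x))%:E <= (expR (m + 8 * b ^+ 2))%:E)%E.
Proof.
move=> mf fm fb.
have fle : forall x, - b <= f x <= b by move=> x; rewrite -ler_norml.
have mb : - b <= m <= b.
  apply/andP; split; first by apply: (has_mean_le (has_mean_cst _) fm) => x; case/andP: (fle x).
  by apply: (has_mean_le fm (has_mean_cst _)) => x; case/andP: (fle x).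
have b0 : 0 <= b := le_trans (normr_ge0 _) (fb point).
rewrite expRD.
have H : has_mean (fun x => expR m * (f x + (expR (8 * b ^+ 2) - m)))
   (expR m * (m + (expR (8 * b ^+ 2) - m))).
  by apply/has_meanZ/has_meanD => //; exact: has_mean_cst.
rewrite addrCA subrr addr0 in H.
apply: (integral_le_mean _ H) => [|x].
  exact: measurableT_comp.
rewrite expR_ge0 /= -{1}(subrK m (f x)) addrC expRD ler_pM2l ?expR_gt0//.
apply: le_trans (expR_le_subgauss _) _.
rewrite addrCA [leRHS]addrC lerD2l ler_expR.
have := fle x; nra.
Qed.

End Means.

Lemma expR1_le4 {R : realType} : expR 1 <= 4 :> R.
Proof.
have h : expR (2^-1) <= 2 :> R.
  rewrite -[2^-1]opprK expRN -[leRHS]invrK lef_pV2 ?posrE ?expR_gt0 ?invr_gt0//.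
  by have := expR_ge1Dx (- 2^-1 : R); lra.
have -> : 1 = 2^-1 + 2^-1 :> R by lra.
by rewrite expRD; have := expR_gt0 (2^-1 : R); nra.
Qed.

(** Put [p = 2 * lam ^+ 2 * sigma ^+ 2]. If [p <= 1], then [expR_le_subgauss] and convexity of the
    exponential give [1 - p + p * m] with [m <= 4], and [1 + 3 * p <= expR (3 * p)]. If [p > 1], a
    crude bound suffices, since constants can be charged to [p]. *)
Lemma subgauss_mgf {R : realType} {dT} {T : measurableType dT} (mu : probability T R)
  (f : T -> R) (sigma lam : R) : 0 < sigma -> measurable_fun setT f -> has_mean mu f 0 ->
  (\int[mu]_x (expR (f x ^+ 2 / sigma ^+ 2))%:E <= (expR 1)%:E)%E ->
  (\int[mu]_x (expR (lam * f x))%:E <= (expR (6 * lam ^+ 2 * sigma ^+ 2))%:E)%E.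
Proof.
move=> s0 mf f0 fE.
have mE : measurable_fun setT (fun x => expR (f x ^+ 2 / sigma ^+ 2)).
  apply: measurableT_comp => //; apply: measurable_funM => //.
  exact: measurable_funX.
have [m fm mle] := ge0_has_mean mE (fun x => expR_ge0 _) fE.
have mG : measurable_fun setT (fun x => expR (lam * f x)).
  by apply: measurableT_comp => //; exact: measurable_funM.
have s2 : 0 < sigma ^+ 2 by rewrite exprn_gt0.
have e4 := @expR1_le4 R.
have [p1|p1] := leP (2 * lam ^+ 2 * sigma ^+ 2) 1.
  set p := 2 * _ * _ in p1.
  have p0 : 0 <= p by rewrite /p -mulrA mulr_ge0// mulr_ge0// sqr_ge0.
  have H : has_mean mu (fun x => lam * f x + ((1 - p) + p * expR (f x ^+ 2 / sigma ^+ 2)))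
      (lam * 0 + ((1 - p) + p * m)).
    by apply: has_meanD; [exact: has_meanZ|apply: has_meanD; [exact: has_mean_cst|exact: has_meanZ]].
  apply: (le_trans (integral_le_mean mG H _)) => [x|].
    rewrite expR_ge0 /=; apply: le_trans (expR_le_subgauss _) _; rewrite lerD2l.
    rewrite (_ : 2 * _ ^+ 2 = p * (f x ^+ 2 / sigma ^+ 2)); last first.
      by rewrite /p; field; rewrite gt_eqF.
    set a := f x ^+ 2 / _.
    (* Tangent line bounds at [p * a]: the combination of [h1] and [h2] with weights [p] and [1 - p]
       is the convexity inequality [expR (p * a) <= 1 - p + p * expR a]. *)
    have h1 : expR (p * a) * (1 + (1 - p) * a) <= expR a.
      rewrite -[in leRHS](_ : p * a + (1 - p) * a = a) ?expRD; last by ring.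
      by rewrite ler_pM2l ?expR_gt0// expR_ge1Dx.
    have h2 : expR (p * a) * (1 - p * a) <= 1.
      rewrite -[leRHS](_ : expR (p * a) * expR (- (p * a)) = 1).
        by rewrite ler_pM2l ?expR_gt0// expR_ge1Dx.
      by rewrite -expRD subrr expR0.
    have h3 := ler_wpM2l p0 h1.
    have q0 : 0 <= 1 - p by lra.
    have h4 := ler_wpM2l q0 h2.
    nra.
  rewrite lee_fin mulr0 add0r.
  apply: (@le_trans _ _ (1 + 3 * p)); first by nra.
  rewrite (_ : 6 * _ * _ = 3 * p) ?expR_ge1Dx// /p; ring.
(* Young's inequality: [lam * f x <= lam ^+ 2 * sigma ^+ 2 / 4 + f x ^+ 2 / sigma ^+ 2]. *)
have H := has_meanZ (expR (lam ^+ 2 * sigma ^+ 2 / 4)) fm.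
apply: (le_trans (integral_le_mean mG H _)) => [x|].
  rewrite expR_ge0 /= -expRD ler_expR -subr_ge0.
  rewrite (_ : _ - _ = (lam * sigma / 2 - f x / sigma) ^+ 2) ?sqr_ge0//.
  by field; rewrite gt_eqF.
rewrite lee_fin; apply: (@le_trans _ _ (expR (lam ^+ 2 * sigma ^+ 2 / 4) * expR 1)).
  by rewrite ler_pM2l ?expR_gt0.
rewrite -expRD ler_expR.
set q := lam ^+ 2 * sigma ^+ 2; rewrite -!mulrA -/q in p1 *; lra.
Qed.

(** * Products over independent samples *)

Section IndependentProducts.
Context {R : realType} {dO dX : measure_display} {O : measurableType dO}
  {X : measurableType dX} {I : eqType}.
Variables (P : probability O R) (Y : I -> O -> X).
Hypothesis mY : forall i, measurable_fun setT (Y i).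
Hypothesis indepY : mutually_independent P Y.

(** Induction on [r]: the samples of the tail are frozen while the head is integrated. *)
Lemma integral_prod_le (r : seq I) (phi : I -> X -> R) (b : I -> R) : uniq r ->
  (forall i, measurable_fun setT (phi i)) -> (forall i x, 0 <= phi i x) ->
  (forall i, i \in r -> (\int[P]_w (phi i (Y i w))%:E <= (b i)%:E)%E) ->
  (\int[P]_w (\prod_(i <- r) phi i (Y i w))%:E <= (\prod_(i <- r) b i)%:E)%E.
Proof.
move=> + mphi phi0; elim: r => [_ _|i r IH /= /andP[ir ur] H].
  rewrite big_nil; under eq_integral do rewrite big_nil.
  by rewrite (integral_cst P measurableT 1%:E) /= probability_setT mule1.
have mcomp Q j : Q j -> measurable_fun setT ((fun w => phi j (Y j w)) : Hist Y Q -> R).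
  by move=> Qj; apply: measurableT_comp => //; exact: Hist_sample.
have mprod : measurable_fun setT
    ((fun w => \prod_(j <- r) phi j (Y j w)) : Hist Y [set j | j \in r] -> R).
  by apply: measurable_prod => j jr; exact: mcomp.
have bi0 : 0 <= b i.
  rewrite -lee_fin; apply: le_trans (H i (mem_head _ _)).
  by apply: integral_ge0 => w _; rewrite lee_fin.
have prod0 w : 0 <= \prod_(j <- r) phi j (Y j w) by apply: prodr_ge0.
pose psi (z : Hist Y [set j | j \in r] * Hist Y [set i]) : \bar R :=
  ((\prod_(j <- r) phi j (Y j z.1)) * phi i (Y i z.2))%:E.
rewrite [leLHS](_ : _ = \int[P]_w psi (w, w))%E; last first.
  by apply: eq_integral => w _; rewrite /psi big_cons mulrC.
apply: (@le_trans _ _ (\int[P]_w ((b i)%:E * (\prod_(j <- r) phi j (Y j w))%:E))%E).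
  apply: (integral_freeze_le mY indepY) => //.
  - by move=> j /= jr ji; move: ir; rewrite -ji jr.
  - apply/measurable_EFinP/measurable_funM.
      exact: (measurableT_comp mprod measurable_fst).
    exact: (measurableT_comp (mcomp [set i] i erefl) measurable_snd).
  - by move=> z; rewrite lee_fin mulr_ge0.
  - by apply/measurable_EFinP/measurable_funM => //; exact: measurable_cst.
  - move=> w; rewrite /psi /=; under eq_integral do rewrite EFinM.
    rewrite ge0_integralZl_EFin//.
    + rewrite muleC lee_wpmul2r ?lee_fin//; exact: H (mem_head _ _).
    + by move=> x _; rewrite lee_fin.
    + by apply/measurable_EFinP; apply: measurableT_comp.
rewrite ge0_integralZl_EFin//.
- rewrite big_cons EFinM lee_wpmul2l ?lee_fin//; apply: IH => // j jr.
  by apply: H; rewrite inE jr orbT.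
- by move=> x _; rewrite lee_fin.
- apply/measurable_EFinP; exact: (Hist_measurable_fun mY mprod).
Qed.

Lemma ge0_integral_law (i : I) (D : probability X R) (phi : X -> \bar R) :
  (forall A, measurable A -> P (Y i @^-1` A) = D A) ->
  measurable_fun setT phi -> (forall x, 0 <= phi x)%E ->
  (\int[P]_w phi (Y i w) = \int[D]_x phi x)%E.
Proof.
move=> law mphi phi0.
pose Yi : {mfun O >-> X} := HB.pack (Y i) (isMeasurableFun.Build _ _ _ _ _ (mY i)).
rewrite (_ : (\int[P]_w phi (Y i w))%E = \int[distribution P Yi]_x phi x)%E.
  by apply: eq_measure_integral => A mA _; exact: law.
by rewrite ge0_integral_distribution.
Qed.

End IndependentProducts.

(** * Averaged oracle answers: exponential moments and tails *)

Definition sample {n : nat} {O X : Type} (xi : nat -> 'I_n -> O -> X)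
  (zeta : nat -> 'I_n -> nat -> O -> X) (s : (nat * 'I_n) + (nat * 'I_n * nat)) : O -> X :=
  match s with
  | inl (t, i) => xi t i
  | inr (t, i, k) => zeta t i k
  end.

Section Oracles.
Context {R : realType} {n : nat} {dO dX : measure_display} {O : measurableType dO}
  {X : measurableType dX}.
Variables (P : probability O R) (D : 'I_n -> probability X R).
Variables (xi : nat -> 'I_n -> O -> X) (zeta : nat -> 'I_n -> nat -> O -> X).
Hypothesis n_gt0 : (0 < n)%N.
Hypothesis xi_law : forall t i, measurable_fun setT (xi t i) /\
  forall A, measurable A -> P (xi t i @^-1` A) = D i A.
Hypothesis zeta_law : forall t i k, measurable_fun setT (zeta t i k) /\
  forall A, measurable A -> P (zeta t i k @^-1` A) = D i A.
Hypothesis indep : mutually_independent P (sample xi zeta).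

Let nR : (0 : R) < n%:R. Proof. by rewrite ltr0n. Qed.

Lemma measurable_sample s : measurable_fun setT (sample xi zeta s).
Proof.
by case: s => [[t i]|[[t i] k]]; [have [] := xi_law t i|have [] := zeta_law t i k].
Qed.

Let worker (s : (nat * 'I_n) + (nat * 'I_n * nat)) : 'I_n :=
  match s with inl (_, i) => i | inr (_, i, _) => i end.

Lemma sample_law s A : measurable A -> P (sample xi zeta s @^-1` A) = D (worker s) A.
Proof.
by case: s => [[t i]|[[t i] k]] mA; [have [_] := xi_law t i|have [_] := zeta_law t i k]; apply.
Qed.

(** Each worker contributes a variable bounded by [M * enorm y / n], so the variances add up to
    order [1 / n]; this gain is given up in the last line. *)
Lemma avg_subgrad_mgf {d : nat} (t : nat) (s : 'I_n -> X -> 'rV[R]_d) (M : R) (y : 'rV[R]_d) :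
  (forall i j, measurable_fun setT (fun x => s i x ord0 j)) ->
  (forall i x, enorm (s i x) <= M) ->
  (\int[P]_w (expR (dotv (n%:R^-1 *: \sum_i s i (xi t i w)) y))%:E <=
   (expR (dotv (n%:R^-1 *: \sum_i vmean (D i) (s i)) y + 8 * M ^+ 2 * enorm y ^+ 2))%:E)%E.
Proof.
move=> ms sM.
have M0 : 0 <= M := le_trans (enorm_ge0 _) (sM (Ordinal n_gt0) point).
pose phi (a : (nat * 'I_n) + (nat * 'I_n * nat)) x := expR (dotv (s (worker a) x) (n%:R^-1 *: y)).
pose b (a : (nat * 'I_n) + (nat * 'I_n * nat)) :=
  expR (dotv (vmean (D (worker a)) (s (worker a))) (n%:R^-1 *: y) + 8 * (M * (n%:R^-1 * enorm y)) ^+ 2).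
pose r : seq ((nat * 'I_n) + (nat * 'I_n * nat)) := [seq inl (t, i) | i <- enum 'I_n].
have mdot i : measurable_fun setT (fun x => dotv (s i x) (n%:R^-1 *: y)).
  by apply: measurable_sum => j; apply: measurable_funM => //; exact: measurable_cst.
have ur : uniq r.
  by rewrite map_inj_uniq ?enum_uniq// => i j [].
have mphi a : measurable_fun setT (phi a) by exact: measurableT_comp (mdot _).
have := @integral_prod_le _ _ _ _ _ _ P (sample xi zeta) measurable_sample indep
  r phi b ur mphi (fun _ _ => expR_ge0 _).
have -> : (\int[P]_w (\prod_(a <- r) phi a (sample xi zeta a w))%:E =
  \int[P]_w (expR (dotv (n%:R^-1 *: \sum_i s i (xi t i w)) y))%:E)%E.
  apply: eq_integral => w _; congr (_%:E).
  rewrite big_map big_enum /= -expR_sum; congr expR.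
  rewrite dotvZl dotv_suml mulr_sumr; apply: eq_bigr => i _.
  by rewrite dotvZr.
move=> /(_ _)/le_trans; apply.
  move=> a ar.
  rewrite (ge0_integral_law (phi := fun z => (phi a z)%:E) measurable_sample (sample_law a))//.
  - rewrite /phi /b; set i := worker a.
    apply: hoeffding_mgf => //; first exact: (@vmean_dotv R dX X (D i) d (s i) M _ (ms i) (sM i)).
    move=> x; apply: le_trans (normr_dotv _ _) _.
    rewrite enormZ ger0_norm ?invr_ge0 ?ler0n//.
    by rewrite ler_wpM2r// mulr_ge0 ?enorm_ge0 ?invr_ge0 ?ler0n.
  - by apply/measurable_EFinP; exact: mphi.
  - by move=> x; rewrite lee_fin expR_ge0.
rewrite lee_fin big_map big_enum /= -expR_sum ler_expR big_split /=.
rewrite dotvZl dotv_suml mulr_sumr; apply: lerD.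
  by rewrite le_eqVlt; apply/orP; left; apply/eqP/eq_bigr => i _; rewrite dotvZr.
rewrite sumr_const card_ord -[leLHS]mulr_natr.
have -> : 8 * (M * (n%:R^-1 * enorm y)) ^+ 2 * n%:R = 8 * M ^+ 2 * enorm y ^+ 2 * n%:R^-1.
  by field; rewrite gt_eqF.
rewrite ler_piMr//; first by rewrite mulr_ge0 ?sqr_ge0// mulr_ge0// sqr_ge0.
by rewrite invf_le1// ler1n.
Qed.

Section ConstraintValues.
Context {d : nat} (gs : 'I_n -> 'rV[R]_d -> X -> R) (G : 'I_n -> 'rV[R]_d -> R).
Variable sigma : R.
Hypothesis sigma_gt0 : 0 < sigma.
Hypothesis mgs : forall i x, measurable_fun setT (gs i x).
Hypothesis gs_mean : forall i x, has_mean (D i) (gs i x) (G i x).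
Hypothesis gs_subgauss : forall i x,
  (\int[D i]_w (expR ((gs i x w - G i x) ^+ 2 / sigma ^+ 2))%:E <= (expR 1)%:E)%E.

Definition ghat_err (N t : nat) (x : 'rV[R]_d) (w : O) : R :=
  n%:R^-1 * \sum_(i < n) batch_value gs zeta N t i x w - n%:R^-1 * \sum_(i < n) G i x.

(** Here the gain of averaging is kept: [n * N] samples of weight [l] leave the variance
    [sigma ^+ 2 / (n * N)], which is why the batch size may scale like [1 / n]. *)
Lemma ghat_err_mgf (N t : nat) (x : 'rV[R]_d) (lam : R) : (0 < N)%N ->
  (\int[P]_w (expR (lam * ghat_err N t x w))%:E <=
   (expR (6 * lam ^+ 2 * sigma ^+ 2 / (n%:R * N%:R)))%:E)%E.
Proof.
move=> N0; have NR : (0 : R) < N%:R by rewrite ltr0n.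
pose l := lam / (n%:R * N%:R).
pose phi (a : (nat * 'I_n) + (nat * 'I_n * nat)) z := expR (l * (gs (worker a) x z - G (worker a) x)).
pose b (a : (nat * 'I_n) + (nat * 'I_n * nat)) := expR (6 * l ^+ 2 * sigma ^+ 2).
pose r : seq ((nat * 'I_n) + (nat * 'I_n * nat)) :=
  [seq inr (t, i, k) | i <- enum 'I_n, k <- iota 0 N].
have ur : uniq r.
  by apply: allpairs_uniq; rewrite ?enum_uniq ?iota_uniq// => -[i k] [j m] _ _ [-> ->].
have mc i : measurable_fun setT (fun z => gs i x z - G i x).
  by apply: measurable_funB => //; exact: measurable_cst.
have mphi a : measurable_fun setT (phi a).
  by apply: measurableT_comp => //; apply: measurable_funM => //; exact: mc.
have := @integral_prod_le _ _ _ _ _ _ P (sample xi zeta) measurable_sample indep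
  r phi b ur mphi (fun _ _ => expR_ge0 _).
have -> : (\int[P]_w (\prod_(a <- r) phi a (sample xi zeta a w))%:E =
  \int[P]_w (expR (lam * ghat_err N t x w))%:E)%E.
  apply: eq_integral => w _; congr (_%:E).
  rewrite big_allpairs_dep /= big_enum /=.
  under eq_bigr do rewrite -expR_sum.
  rewrite -expR_sum; congr expR.
  rewrite /ghat_err -mulrBr -sumrB mulrA mulr_sumr; apply: eq_bigr => i _.
  rewrite -mulr_sumr /= -[N in iota _ N]subn0 -/(index_iota 0 N) big_mkord sumrB.
  rewrite sumr_const card_ord -[X in _ - X]mulr_natr /batch_value /l.
  by field; rewrite !gt_eqF.
move=> /(_ _)/le_trans; apply.
  move=> a ar.
  rewrite (ge0_integral_law (phi := fun z => (phi a z)%:E) measurable_sample (sample_law a))//.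
  - rewrite /phi /b; set i := worker a.
    apply: (subgauss_mgf (f := fun z => gs i x z - G i x)) => //.
    have := has_meanD (gs_mean i x) (has_mean_cst (D i) (- G i x)).
    by rewrite subrr.
  - by apply/measurable_EFinP; exact: mphi.
  - by move=> z; rewrite lee_fin expR_ge0.
rewrite lee_fin big_allpairs_dep /= big_enum /= /b.
under eq_bigr do rewrite -expR_sum.
rewrite -expR_sum ler_expR.
under eq_bigr do rewrite -[N in iota _ N]subn0 -/(index_iota 0 N) big_mkord sumr_const card_ord.
rewrite sumr_const card_ord -mulrnA -[leLHS]mulr_natr natrM /l.
rewrite le_eqVlt; apply/orP; left; apply/eqP.
by field; rewrite !gt_eqF.
Qed.

Lemma measurable_ghat_err (N t : nat) (x : 'rV[R]_d) :
  measurable_fun setT (ghat_err N t x).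
Proof.
apply: measurable_funB; last exact: measurable_cst.
apply: measurable_funM; first exact: measurable_cst.
apply: measurable_sum => i.
apply: measurable_funM; first exact: measurable_cst.
apply: measurable_sum => k.
by apply: measurableT_comp => //; have [] := zeta_law t i k.
Qed.

Lemma ghat_err_tail (N t : nat) (x : 'rV[R]_d) (eps : R) : (0 < N)%N -> 0 < eps ->
  (\int[P]_w (if eps < `|ghat_err N t x w| then 1 else 0)%:E <=
   (2 * expR (- (n%:R * N%:R * eps ^+ 2 / (24 * sigma ^+ 2))))%:E)%E.
Proof.
move=> N0 e0; have NR : (0 : R) < N%:R by rewrite ltr0n.
(* Minimiser of the Chernoff exponent [- (lam * eps) + 6 * lam ^+ 2 * sigma ^+ 2 / (n * N)]. The
   signs of [lam] correspond to the two tails. *)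
pose lam := n%:R * N%:R * eps / (12 * sigma ^+ 2).
have s2 : 0 < sigma ^+ 2 by rewrite exprn_gt0.
have lam0 : 0 < lam by rewrite /lam !mulr_gt0// invr_gt0 mulr_gt0.
have mexp k : measurable_fun setT (fun w => expR (k * ghat_err N t x w)).
  by apply: measurableT_comp => //; apply: measurable_funM => //; exact: measurable_ghat_err.
have [m1 h1 le1] := ge0_has_mean (mexp lam) (fun _ => expR_ge0 _) (ghat_err_mgf t x lam N0).
have [m2 h2 le2] := ge0_has_mean (mexp (- lam)) (fun _ => expR_ge0 _) (ghat_err_mgf t x (- lam) N0).
have H := has_meanZ (expR (- (lam * eps))) (has_meanD h1 h2).
have mI : measurable_fun setT (fun w => if eps < `|ghat_err N t x w| then 1 else 0 : R).
  apply: measurable_fun_ifT => //; apply: measurable_fun_ltr => //.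
  by apply: measurableT_comp => //; exact: measurable_ghat_err.
apply: (le_trans (integral_le_mean mI H _)) => [w|].
  apply/andP; split; first by case: ifP.
  rewrite mulrDr -!expRD; case: ifP => [|_]; last by rewrite addr_ge0 ?expR_ge0.
  set z := ghat_err _ _ _ _.
  have [z0|z0] := leP 0 z => ez.
    rewrite -[leLHS]addr0 lerD ?expR_ge0// -expR0 ler_expR.
    by move: ez; rewrite ger0_norm// => ez; nra.
  rewrite -[leLHS]add0r lerD ?expR_ge0// -expR0 ler_expR.
  by move: ez; rewrite ltr0_norm// => ez; nra.
rewrite lee_fin sqrrN in le2 *.
apply: (@le_trans _ _ (expR (- (lam * eps)) * (2 * expR (6 * lam ^+ 2 * sigma ^+ 2 / (n%:R * N%:R))))).
  rewrite ler_pM2l ?expR_gt0//; lra.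
rewrite mulrCA ler_pM2l// -expRD ler_expR le_eqVlt; apply/orP; left; apply/eqP.
by rewrite /lam; field; rewrite !gt_eqF.
Qed.

End ConstraintValues.
End Oracles.

(** * The trajectory of Safe-EF *)

Section Process.
Context {R : realType} {d n : nat} {dO dX : measure_display} {O : measurableType dO}
  {X : measurableType dX}.
Variables (P : probability O R) (D : 'I_n -> probability X R).
Variables (xi : nat -> 'I_n -> O -> X) (zeta : nat -> 'I_n -> nat -> O -> X).
Variables (gs : 'I_n -> 'rV[R]_d -> X -> R) (fsub gsub : 'I_n -> 'rV[R]_d -> X -> 'rV[R]_d).
Variables (F G : 'I_n -> 'rV[R]_d -> R) (C : 'I_n -> 'rV[R]_d -> 'rV[R]_d).
Variables (M delta gamma c : R) (x0 : 'rV[R]_d) (Nfv : nat).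

Hypothesis n_gt0 : (0 < n)%N.
Hypothesis xi_law : forall t i, measurable_fun setT (xi t i) /\
  forall A, measurable A -> P (xi t i @^-1` A) = D i A.
Hypothesis zeta_law : forall t i k, measurable_fun setT (zeta t i k) /\
  forall A, measurable A -> P (zeta t i k @^-1` A) = D i A.
Hypothesis indep : mutually_independent P (sample xi zeta).
Hypothesis oracle_measurable : forall i (j : 'I_d),
  measurable_fun setT (fun p : VecM R d * X => vcoord j (fsub i p.1 p.2)) /\
  measurable_fun setT (fun p : VecM R d * X => vcoord j (gsub i p.1 p.2)) /\
  measurable_fun setT (fun p : VecM R d * X => gs i p.1 p.2) /\
  measurable_fun setT (fun v : VecM R d => vcoord j (C i v)).
(* For [d = 0] this is not part of [oracle_measurable], which quantifies over a coordinate. *)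
Hypothesis mgs : forall i, measurable_fun setT (fun p : VecM R d * X => gs i p.1 p.2).
Hypothesis sub_le : forall i x w, enorm (fsub i x w) <= M /\ enorm (gsub i x w) <= M.
Hypothesis sub_mean : forall i x, is_subgrad (F i) x (vmean (D i) (fsub i x)) /\
  is_subgrad (G i) x (vmean (D i) (gsub i x)).
Hypothesis C_contractive : forall i, contractive delta (C i).
Hypothesis delta01 : 0 < delta <= 1.
Hypothesis M_ge0 : 0 <= M.
Hypothesis gamma_gt0 : 0 < gamma.

Let nR : (0 : R) < n%:R. Proof. by rewrite ltr0n. Qed.
Let delta_gt0 : 0 < delta. Proof. by case/andP: delta01. Qed.
Let delta_le1 : delta <= 1. Proof. by case/andP: delta01. Qed.
Let mY := measurable_sample xi_law zeta_law.

Definition fbar (x : 'rV[R]_d) : R := n%:R^-1 * \sum_(i < n) F i x.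
Definition gbar (x : 'rV[R]_d) : R := n%:R^-1 * \sum_(i < n) G i x.

Definition ghat (w : O) (t : nat) (x : 'rV[R]_d) : R :=
  n%:R^-1 * \sum_(i < n) batch_value gs zeta Nfv t i x w.
Definition state (w : O) (t : nat) := safe_ef_state gamma c x0 C (ghat w)
  (fun t i x => fsub i x (xi t i w)) (fun t i x => gsub i x (xi t i w)) t.
Definition xt (t : nat) (w : O) : 'rV[R]_d := (state w t).1.
Definition et (t : nat) (i : 'I_n) (w : O) : 'rV[R]_d := (state w t).2 i.
Definition bt (t : nat) (w : O) : bool := ghat w t (xt t w) <= c.
(* [w] determines the past, [w'] supplies the fresh subgradient samples. *)
Definition ht (t : nat) (i : 'I_n) (w w' : O) : 'rV[R]_d :=
  if bt t w then fsub i (xt t w) (xi t i w') else gsub i (xt t w) (xi t i w').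
Definition xh (t : nat) (w : O) : 'rV[R]_d :=
  xt t w - (gamma / n%:R) *: \sum_(i < n) et t i w.
Definition xnext (t : nat) (w w' : O) : 'rV[R]_d :=
  xh t w - gamma *: (n%:R^-1 *: \sum_(i < n) ht t i w w').

Lemma et_S t i w : et t.+1 i w = et t i w + ht t i w w - C i (et t i w + ht t i w w).
Proof. by []. Qed.

Lemma xt_S t w :
  xt t.+1 w = xt t w - (gamma / n%:R) *: \sum_(i < n) C i (et t i w + ht t i w w).
Proof. by []. Qed.

Lemma xh_S t w : xh t.+1 w = xnext t w w.
Proof.
rewrite /xnext /xh xt_S (eq_bigr _ (fun i _ => et_S t i w)).
rewrite sumrB big_split /= scalerA.
set c1 := \sum_i _; set c2 := \sum_i _; set c3 := \sum_i _.
by apply/rowP => j; rewrite !mxE; ring.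
Qed.

Lemma xh_0 w : xh 0 w = x0.
Proof. by rewrite /xh /xt /et /= big1// scaler0 subr0. Qed.

Lemma ht_le t i w w' : enorm (ht t i w w') <= M.
Proof. by rewrite /ht; case: ifP => _; have [] := sub_le i (xt t w) (xi t i w'). Qed.

(* The error recursion contracts by [sqrt (1 - delta) <= 1 - delta / 2]. *)
Lemma et_le t i w : enorm (et t i w) <= 2 * M / delta.
Proof.
elim: t => [|t IH].
  by rewrite /et /= enorm0 divr_ge0 ?mulr_ge0// ltW.
have d0 : 0 < delta by []. have d1 : delta <= 1 by [].
rewrite et_S enormC.
set v := et t i w + _.
have v_le : enorm v <= 2 * M / delta + M.
  by apply: le_trans (ler_enormD _ _) (lerD IH (ht_le _ _ _ _)).
have h := C_contractive i v.
have h2 : enorm (C i v - v) <= (1 - delta / 2) * enorm v.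
  rewrite -(@ler_pXn2r _ 2)// ?nnegrE ?enorm_ge0//; last first.
    by rewrite mulr_ge0 ?enorm_ge0//; lra.
  apply: (le_trans h); rewrite exprMn; apply: ler_wpM2r; first exact: sqr_ge0.
  by have := sqr_ge0 delta; nra.
apply: (le_trans h2); apply: (@le_trans _ _ ((1 - delta / 2) * (2 * M / delta + M))).
  by apply: ler_wpM2l => //; lra.
rewrite -subr_ge0 (_ : _ - _ = delta * M / 2).
  by rewrite divr_ge0// mulr_ge0// ltW.
by field; rewrite gt_eqF.
Qed.

Lemma xt_xh_le t w : enorm (xt t w - xh t w) <= gamma * (2 * M / delta).
Proof.
rewrite /xh opprB addrC subrK -scalerA enormZ ger0_norm ?(ltW gamma_gt0)//.
by apply: ler_wpM2l; [exact: ltW|apply: enorm_avg_le => // i; exact: et_le].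
Qed.

(** * Filtration and measurability of the trajectory *)

Definition sample_time (s : (nat * 'I_n) + (nat * 'I_n * nat)) : nat :=
  match s with inl (t, _) => t | inr (t, _, _) => t end.
Definition is_value_sample (s : (nat * 'I_n) + (nat * 'I_n * nat)) : bool :=
  if s is inr _ then true else false.

Definition past (t : nat) : set ((nat * 'I_n) + (nat * 'I_n * nat)) :=
  [set s | (sample_time s < t)%N].
(** The branch taken at time [t] depends on the constraint values of time [t]. An iteration is
    therefore frozen at two moments: before these values, to estimate their error, and after them
    but before the subgradient samples, for the descent step. *)
Definition past_values (t : nat) : set ((nat * 'I_n) + (nat * 'I_n * nat)) :=
  [set s | (sample_time s < t)%N \/ (sample_time s = t /\ is_value_sample s)].
Definition now_values (t : nat) : set ((nat * 'I_n) + (nat * 'I_n * nat)) :=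
  [set s | sample_time s = t /\ is_value_sample s].
Definition now_subgrads (t : nat) : set ((nat * 'I_n) + (nat * 'I_n * nat)) :=
  [set s | sample_time s = t /\ ~~ is_value_sample s].

Notation History Q := (Hist (sample xi zeta) Q).

Lemma past_sub t : past t `<=` past_values t.
Proof. by move=> s; left. Qed.
Lemma past_values_sub t : past_values t `<=` past t.+1.
Proof. by move=> s [|[<- _]]; rewrite /past /= ltnS// => /ltnW. Qed.

Lemma xi_measurable Q t i : Q (inl (t, i)) ->
  measurable_fun setT (xi t i : History Q -> X).
Proof. exact: (@Hist_sample _ _ _ _ _ (sample xi zeta) Q (inl (t, i))). Qed.

Lemma zeta_measurable Q t i k : Q (inr (t, i, k)) ->
  measurable_fun setT (zeta t i k : History Q -> X).
Proof. exact: (@Hist_sample _ _ _ _ _ (sample xi zeta) Q (inr (t, i, k))). Qed.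

Section GenericSpace.
Context {dT : measure_display} {T : measurableType dT}.
Variables (x : T -> VecM R d) (z : T -> X).
Hypotheses (mx : measurable_fun setT x) (mz : measurable_fun setT z).

Lemma measurable_fsub i : measurable_fun setT (fun a => fsub i (x a) (z a) : VecM R d).
Proof.
apply: measurable_vecP => j.
exact: (measurableT_comp (oracle_measurable i j).1 (measurable_fun_pair mx mz)).
Qed.

Lemma measurable_gsub i : measurable_fun setT (fun a => gsub i (x a) (z a) : VecM R d).
Proof.
apply: measurable_vecP => j.
exact: (measurableT_comp (oracle_measurable i j).2.1 (measurable_fun_pair mx mz)).
Qed.

Lemma measurable_compressor i : measurable_fun setT (fun a => C i (x a) : VecM R d).
Proof.
apply: measurable_vecP => j.
exact: (measurableT_comp (oracle_measurable i j).2.2.2 mx).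
Qed.

End GenericSpace.

Lemma measurable_ghat {dT} {T : measurableType dT} (x : T -> VecM R d) (v : T -> O) t :
  measurable_fun setT x -> (forall i k, measurable_fun setT (zeta t i k \o v)) ->
  measurable_fun setT (fun a => ghat (v a) t (x a)).
Proof.
move=> mx mv; apply: measurable_funM; first exact: measurable_cst.
apply: measurable_sum => i.
apply: measurable_funM; first exact: measurable_cst.
apply: measurable_sum => k.
exact: (measurableT_comp (mgs i) (measurable_fun_pair mx (mv i k))).
Qed.

Lemma state_measurable t :
  measurable_fun setT (xt t : History (past t) -> VecM R d) /\
  forall i, measurable_fun setT (et t i : History (past t) -> VecM R d).
Proof.
elim: t => [|t [IHx IHe]].
  by split => [|i]; exact: measurable_cst.
have sub : past t `<=` past t.+1 by move=> s /past_sub /past_values_sub.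
have mx := HistS sub IHx; have me i := HistS sub (IHe i).
have mb : measurable_fun setT (bt t : History (past t.+1) -> bool).
  apply: measurable_fun_ler; last exact: measurable_cst.
  apply: measurable_ghat => // i k; apply: zeta_measurable.
  by rewrite /past /= ltnS.
have mxi i : measurable_fun setT (xi t i : History (past t.+1) -> X).
  by apply: xi_measurable; rewrite /past /= ltnS.
have mh i : measurable_fun setT ((fun w => ht t i w w) : History (past t.+1) -> VecM R d).
  by apply: measurable_fun_ifT => //; [exact: measurable_fsub|exact: measurable_gsub].
have meh i := measurable_vecD (me i) (mh i).
split => [|i].
  apply: (measurable_vecB mx); apply: measurable_vecZ; apply: measurable_vec_sum => i.
  exact: (measurable_compressor (meh i) i).
exact: (measurable_vecB (meh i) (measurable_compressor (meh i) i)).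
Qed.


Lemma past_values_measurable t : [/\
  measurable_fun setT (xt t : History (past_values t) -> VecM R d),
  measurable_fun setT (xh t : History (past_values t) -> VecM R d),
  measurable_fun setT ((fun w => ghat w t (xt t w)) : History (past_values t) -> R) &
  measurable_fun setT (bt t : History (past_values t) -> bool)].
Proof.
have [IHx IHe] := state_measurable t.
have mx := HistS (@past_sub t) IHx; have me i := HistS (@past_sub t) (IHe i).
have mg : measurable_fun setT ((fun w => ghat w t (xt t w)) : History (past_values t) -> R).
  by apply: measurable_ghat => // i k; apply: zeta_measurable; right.
split => //.
  by apply: (measurable_vecB mx); apply: measurable_vecZ; exact: measurable_vec_sum.
by apply: measurable_fun_ler => //; exact: measurable_cst.
Qed.

Lemma xnext_measurable t : measurable_fun setT
  ((fun z => xnext t z.1 z.2) :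
     History (past_values t) * History (now_subgrads t) -> VecM R d).
Proof.
have [mx mxh _ mb] := past_values_measurable t.
have mx1 := measurableT_comp mx measurable_fst.
have mxi i : measurable_fun setT ((fun z => xi t i z.2) :
     History (past_values t) * History (now_subgrads t) -> X).
  apply: (@measurableT_comp _ _ _ _ _ _ (xi t i : History (now_subgrads t) -> X) _ snd).
    exact: xi_measurable.
  exact: measurable_snd.
apply: measurable_vecB; first exact: (measurableT_comp mxh measurable_fst).
do 2 apply: measurable_vecZ; apply: measurable_vec_sum => i.
apply: measurable_fun_ifT; first exact: (measurableT_comp mb measurable_fst).
- apply: (@measurable_fsub _ (History (past_values t) * History (now_subgrads t))%type
    (fun z => xt t z.1) (fun z => xi t i z.2)); [exact: mx1|exact: mxi].
- apply: (@measurable_gsub _ (History (past_values t) * History (now_subgrads t))%type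
    (fun z => xt t z.1) (fun z => xi t i z.2)); [exact: mx1|exact: mxi].
Qed.

(** * One step of the corrected iterate *)

Definition gap (t : nat) (w : O) (u : 'rV[R]_d) : R :=
  if bt t w then fbar (xt t w) - fbar u else gbar (xt t w) - gbar u.

Lemma subgrad_gap t w u : gap t w u <=
  dotv (n%:R^-1 *: \sum_i vmean (D i) (if bt t w then fsub i (xt t w) else gsub i (xt t w)))
    (xt t w - u).
Proof.
have H (Phi : 'I_n -> 'rV[R]_d -> R) (v : 'I_n -> 'rV[R]_d) :
    (forall i, is_subgrad (Phi i) (xt t w) (v i)) ->
    n%:R^-1 * (\sum_(i < n) Phi i (xt t w)) - n%:R^-1 * (\sum_(i < n) Phi i u) <=
    dotv (n%:R^-1 *: \sum_i v i) (xt t w - u).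
  move=> Hs; rewrite -mulrBr -sumrB dotvZl dotv_suml ler_wpM2l ?invr_ge0 ?ler0n//.
  apply: ler_sum => i _; have := Hs i u.
  by rewrite -(opprB (xt t w) u) dotvNr; lra.
by rewrite /gap; case: ifP => _; apply: H => i; have [] := sub_mean i (xt t w).
Qed.

(** Order of the loss per step: the compression error [gamma * M / delta] times the step length
    [gamma * M]. It dominates the usual [gamma ^+ 2 * M ^+ 2]. *)
Definition step_cost : R := gamma ^+ 2 * M ^+ 2 / delta.

(** The square is expanded around [xh], but the subgradients belong to [xt]. Exchanging the points
    costs [4 * step_cost] and the quadratic term one more. The last two terms come from the noise,
    whose variance scales with the squared distance from [xt] to [u]. *)
Lemma step_mgf t w u lam : 0 <= lam ->
  (\int[P]_w' (expR (lam * enorm (xnext t w w' - u) ^+ 2))%:E <=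
   (expR (lam * (enorm (xh t w - u) ^+ 2 - 2 * gamma * gap t w u + 5 * step_cost) +
    64 * lam ^+ 2 * step_cost * enorm (xh t w - u) ^+ 2 +
    256 * lam ^+ 2 * step_cost ^+ 2))%:E)%E.
Proof.
move=> lam0; set a := step_cost; set V := enorm (xh t w - u) ^+ 2.
have a0 : 0 <= a by rewrite /a /step_cost divr_ge0 ?(ltW delta_gt0)// mulr_ge0// sqr_ge0.
pose s i := if bt t w then fsub i (xt t w) else gsub i (xt t w).
pose h w' := n%:R^-1 *: \sum_(i < n) ht t i w w'.
have hE w' : h w' = n%:R^-1 *: \sum_(i < n) s i (xi t i w').
  by congr (_ *: _); apply: eq_bigr => i _; rewrite /ht /s; case: ifP.
have mconst : measurable_fun setT (fun _ : X => xt t w : VecM R d) by exact: measurable_cst.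
have ms i j : measurable_fun setT (fun x => s i x ord0 j).
  apply: (@measurable_coord _ _ _ _ (fun x => s i x : VecM R d)).
  rewrite /s; case: ifP => _.
    exact: (measurable_fsub mconst (@measurable_id _ _ setT)).
  exact: (measurable_gsub mconst (@measurable_id _ _ setT)).
have sM i x : enorm (s i x) <= M by rewrite /s; case: ifP => _; have [] := sub_le i (xt t w) x.
pose y := (- (2 * lam * gamma)) *: (xt t w - u).
have e_le := xt_xh_le t w; set e := enorm _ in e_le.
have key w' : lam * enorm (xnext t w w' - u) ^+ 2 <= lam * (V + 5 * a) + dotv (h w') y.
  have hM : enorm (h w') <= M by apply: enorm_avg_le => // i; exact: ht_le.
  have -> : xnext t w w' - u = (xh t w - u) - gamma *: h w'.
    by rewrite /xnext addrAC.
  have e0 : 0 <= e by exact: enorm_ge0.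
  have gM : gamma * e * M <= 2 * a.
    rewrite (_ : 2 * a = gamma * (gamma * (2 * M / delta)) * M); last first.
      by rewrite /a /step_cost; field; rewrite gt_eqF.
    by rewrite ler_wpM2r// ler_wpM2l// ltW.
  have gg : gamma ^+ 2 * M ^+ 2 <= a.
    by rewrite /a /step_cost; apply: ler_peMr; [apply: mulr_ge0; exact: sqr_ge0|rewrite invf_ge1].
  have hh : gamma ^+ 2 * enorm (h w') ^+ 2 <= a.
    apply: le_trans gg; apply: ler_wpM2l; first exact: sqr_ge0.
    by rewrite ler_sqr// nnegrE enorm_ge0.
  have he : gamma * dotv (xt t w - xh t w) (h w') <= 2 * a.
    apply: le_trans gM; rewrite -mulrA ler_wpM2l ?(ltW gamma_gt0)//.
    apply: le_trans (dotv_le_enorm _ _) _; rewrite -/e ler_wpM2l//.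
  rewrite enorm_sqrB (dotvZr gamma) enormZ ger0_norm ?(ltW gamma_gt0)// exprMn /y.
  rewrite [dotv (h w') (_ *: _)](dotvZr _ (h w')).

  have -> : dotv (xh t w - u) (h w') =
      dotv (h w') (xt t w - u) - dotv (xt t w - xh t w) (h w').
    by rewrite (dotvC (h w')) -dotvBl opprB [in RHS]addrC addrA subrK.
  set A := dotv (h w') _; set B := dotv (xt t w - _) _ in he *.
  rewrite -/V (_ : _ + - _ * A = lam * (V + 5 * a - 2 * gamma * A)); last by ring.
  by apply: ler_wpM2l => //; lra.
have m1 : measurable_fun setT (fun w' => expR (lam * enorm (xnext t w w' - u) ^+ 2)).
  apply: measurableT_comp => //; apply: measurable_funM => //.
  under eq_fun do rewrite enorm_sqr.
  have mnext : measurable_fun setT (xnext t w : History (now_subgrads t) -> VecM R d).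
    have := measurableT_comp (@xnext_measurable t) (@pair1_measurable _ _
      (History (past_values t)) (History (now_subgrads t)) w).
    exact.
  have mn := Hist_measurable_fun mY mnext.
  by apply: measurable_dotv; apply: measurable_vecB => //; exact: measurable_cst.
have m2 : measurable_fun setT (fun w' => expR (dotv (h w') y)).
  under eq_fun do rewrite hE.
  apply: measurableT_comp => //; apply: measurable_dotv; last exact: measurable_cst.
  apply: measurable_vecZ; apply: measurable_vec_sum => i.
  apply: measurable_vecP => j; exact: (measurableT_comp (ms i j) (xi_law t i).1).
have hmgf := avg_subgrad_mgf n_gt0 xi_law zeta_law indep t y ms sM.
have hm0 : (\int[P]_w' (expR (dotv (h w') y))%:E <= (expR
    (dotv (n%:R^-1 *: \sum_i vmean (D i) (s i)) y + 8 * M ^+ 2 * enorm y ^+ 2))%:E)%E.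
  by apply: le_trans hmgf; under eq_integral do rewrite hE.
have [m hm mle] := ge0_has_mean m2 (fun _ => expR_ge0 _) hm0.
have H := has_meanZ (expR (lam * (V + 5 * a))) hm.
apply: (le_trans (integral_le_mean m1 H _)) => [w'|].
  by rewrite expR_ge0 -expRD ler_expR key.
rewrite lee_fin; apply: (le_trans (ler_wpM2l (expR_ge0 _) mle)).
rewrite -expRD ler_expR /y dotvZr enormZ exprMn real_normK ?num_real//.
have := subgrad_gap t w u; 
set q := dotv _ _ => gapq.
have lg0 : 0 <= 2 * lam * gamma by rewrite mulr_ge0 ?mulr_ge0// ltW.
have h1 := ler_wpM2l lg0 gapq.
have xu : enorm (xt t w - u) ^+ 2 <= 2 * V + 8 * (gamma ^+ 2 * M ^+ 2 / delta ^+ 2).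
  have -> : xt t w - u = (xh t w - u) + (xt t w - xh t w) by rewrite [RHS]addrC addrA subrK.
  apply: le_trans (enorm_sqrD_le _ _) _; rewrite -/V -/e lerD2l.
  have : e ^+ 2 <= (gamma * (2 * M / delta)) ^+ 2 by rewrite !expr2; apply: ler_pM => //; exact: enorm_ge0.
  rewrite (_ : (gamma * _) ^+ 2 = 4 * (gamma ^+ 2 * M ^+ 2 / delta ^+ 2)); first by lra.
  by field; rewrite gt_eqF.
(* The squared distance from [xt] to [xh] brings [step_cost / delta], and the variance has the
   prefactor [delta * step_cost]: the negative powers of [delta] cancel. *)
have gd : gamma ^+ 2 * M ^+ 2 = delta * a by rewrite /a /step_cost; field; rewrite gt_eqF.
have gdd : gamma ^+ 2 * M ^+ 2 / delta ^+ 2 = a / delta by rewrite /a /step_cost; field; rewrite gt_eqF.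
rewrite gdd in xu.
have h2 : 8 * M ^+ 2 * ((- (2 * lam * gamma)) ^+ 2 * enorm (xt t w - u) ^+ 2) <=
    64 * lam ^+ 2 * a * V + 256 * lam ^+ 2 * a ^+ 2.
  rewrite (_ : 8 * _ * _ = 32 * lam ^+ 2 * (gamma ^+ 2 * M ^+ 2) * enorm (xt t w - u) ^+ 2); last by ring.
  rewrite gd; apply: (@le_trans _ _ (32 * lam ^+ 2 * (delta * a) * (2 * V + 8 * (a / delta)))).
    apply: ler_wpM2l xu; apply: mulr_ge0; first by apply: mulr_ge0 => //; exact: sqr_ge0.
    by apply: mulr_ge0 => //; exact: ltW.
  rewrite (_ : 32 * _ * _ * _ = 64 * lam ^+ 2 * a * V * delta + 256 * lam ^+ 2 * a ^+ 2); last first.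
    by field; rewrite gt_eqF.
  rewrite lerD2r ler_piMr//; apply: mulr_ge0; last exact: sqr_ge0.
  by apply: mulr_ge0 => //; apply: mulr_ge0 => //; exact: sqr_ge0.
lra.
Qed.


Lemma past_values_mono s t : (s <= t)%N -> past_values s `<=` past_values t.
Proof.
rewrite leq_eqVlt => /predU1P[->//|st] a; case => [ast|[ast _]]; left => /=.
  exact: ltn_trans ast st.
by rewrite ast.
Qed.

(** Subgradients of norm at most [M] at every point yield Lipschitz continuity, hence measurability,
    as well as Jensen's inequality. *)
Lemma fbar_subgrad x : exists2 v, enorm v <= M & is_subgrad fbar x v.
Proof.
exists (n%:R^-1 *: \sum_i vmean (D i) (fsub i x)).
  apply: enorm_avg_le => // i; apply: enorm_vmean_le => [j|z].
    exact: (measurable_coord (f := fun z => fsub i x z : VecM R d) j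
      (measurable_fsub (measurable_cst (x : VecM R d)) (@measurable_id _ X setT) i)).
  by have [] := sub_le i x z.
move=> u; rewrite /fbar dotvZl dotv_suml -mulrDr -big_split ler_wpM2l ?invr_ge0 ?ler0n//=.
by apply: ler_sum => i _; have [] := sub_mean i x.
Qed.

Lemma gbar_subgrad x : exists2 v, enorm v <= M & is_subgrad gbar x v.
Proof.
exists (n%:R^-1 *: \sum_i vmean (D i) (gsub i x)).
  apply: enorm_avg_le => // i; apply: enorm_vmean_le => [j|z].
    exact: (measurable_coord (f := fun z => gsub i x z : VecM R d) j
      (measurable_gsub (measurable_cst (x : VecM R d)) (@measurable_id _ X setT) i)).
  by have [] := sub_le i x z.
move=> u; rewrite /gbar dotvZl dotv_suml -mulrDr -big_split ler_wpM2l ?invr_ge0 ?ler0n//=.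
by apply: ler_sum => i _; have [] := sub_mean i x.
Qed.

Lemma subgrad_lipschitz (h : 'rV[R]_d -> R) :
  (forall x, exists2 v, enorm v <= M & is_subgrad h x v) ->
  forall x u, h x <= h u + M * enorm (x - u).
Proof.
move=> H x u; have [v vM /(_ u) hv] := H x.
have : dotv v (x - u) <= M * enorm (x - u).
  by apply: le_trans (dotv_le_enorm _ _) _; rewrite ler_wpM2r ?enorm_ge0.
move: hv; rewrite -(opprB x u) dotvNr; lra.
Qed.

Lemma measurable_fbar : measurable_fun setT (fbar : VecM R d -> R).
Proof. exact: (measurable_lipschitz M_ge0 (subgrad_lipschitz fbar_subgrad)). Qed.

Lemma measurable_gbar : measurable_fun setT (gbar : VecM R d -> R).
Proof. exact: (measurable_lipschitz M_ge0 (subgrad_lipschitz gbar_subgrad)). Qed.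

(** The affine minorant of [h] at the mean point is summed; its linear part cancels. *)
Lemma jensen (h : 'rV[R]_d -> R) (s : seq nat) (x : nat -> 'rV[R]_d) :
  (forall x, exists2 v, enorm v <= M & is_subgrad h x v) ->
  (0 < size s)%N ->
  (size s)%:R * h ((size s)%:R^-1 *: \sum_(t <- s) x t) <= \sum_(t <- s) h (x t).
Proof.
move=> H s0; have sR : (0 : R) < (size s)%:R by rewrite ltr0n.
set xb := _ *: _.
have [v _ hv] := H xb.
have sub0 : \sum_(t <- s) (x t - xb) = 0.
  rewrite sumrB big_const_seq count_predT iter_addr_0 -[xb *+ _]scaler_nat /xb.
  by rewrite scalerA divff ?scale1r ?subrr// gt_eqF.
have -> : (size s)%:R * h xb = \sum_(t <- s) (h xb + dotv v (x t - xb)).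
  rewrite big_split /= big_const_seq count_predT iter_addr_0.
  under [X in _ + X]eq_bigr do rewrite dotvC.
  by rewrite -dotv_suml sub0 dotv0l addr0 mulr_natl.
by apply: ler_sum => t _; exact: hv.
Qed.

(** Both [q t] and [ell t.+1] are known before the subgradient samples of time [t]. Freezing them
    and integrating over these samples removes the last step. Since [ell] is random, a process can
    be stopped by setting it to 0. *)
Lemma exp_supermartingale (Q : VecM R d -> R) (ell q : nat -> O -> R) (l0 : R) (T : nat) :
  measurable_fun setT Q -> (forall w, ell 0 w = l0) ->
  (forall t, measurable_fun setT (ell t.+1 : History (past_values t) -> R)) ->
  (forall t, measurable_fun setT (q t : History (past_values t) -> R)) ->
  (forall t w, 0 <= q t w) ->
  (forall t w, (t < T)%N -> ((q t w)%:E * \int[P]_w' (expR (ell t.+1 w * Q (xnext t w w')))%:E <=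
    (expR (ell t w * Q (xh t w)))%:E)%E) ->
  (\int[P]_w (\prod_(s < T) q s w * expR (ell T w * Q (xh T w)))%:E <= (expR (l0 * Q x0))%:E)%E.
Proof.
move=> mQ ell0 mell mq q0.
have mell' t : measurable_fun setT (ell t : History (past_values t) -> R).
  case: t => [|t]; last exact: (HistS (past_values_mono (leqnSn t)) (mell t)).
  by rewrite (_ : ell 0 = cst l0) ?funeqE//; exact: measurable_cst.
have mq' s t : (s <= t)%N -> measurable_fun setT (q s : History (past_values t) -> R).
  by move=> st; exact: (HistS (past_values_mono st) (mq s)).
have mprod s t : (s <= t.+1)%N ->
    measurable_fun setT ((fun w => \prod_(k < s) q k w) : History (past_values t) -> R).
  move=> st; apply: measurable_prod => k _; apply: mq'.
  by rewrite -ltnS; apply: leq_trans st.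
have prod0 s w : 0 <= \prod_(k < s) q k w by apply: prodr_ge0.
elim: T => [_|T IH Hq].
  under eq_integral do rewrite big_ord0 mul1r xh_0 ell0.
  by rewrite (integral_cst P measurableT (expR (l0 * Q x0))%:E) /= probability_setT mule1.
have [mx mxh _ _] := past_values_measurable T.
pose psi (z : History (past_values T) * History (now_subgrads T)) : \bar R :=
  (\prod_(s < T.+1) q s z.1 * expR (ell T.+1 z.1 * Q (xnext T z.1 z.2)))%:E.
have mQn : measurable_fun setT (fun z : History (past_values T) * History (now_subgrads T) =>
    expR (ell T.+1 z.1 * Q (xnext T z.1 z.2))).
  apply: measurableT_comp => //; apply: measurable_funM.
    exact: (measurableT_comp (mell T) measurable_fst).
  exact: (measurableT_comp mQ (@xnext_measurable T)).
rewrite [leLHS](_ : _ = \int[P]_w psi (w, w))%E; last first.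
  by apply: eq_integral => w _; rewrite /psi /= xh_S.
apply: le_trans (IH _); last by move=> t w tT; apply: Hq; exact: ltnW.
apply: (integral_freeze_le mY indep) => //.
- by move=> a [/= aT|[/= aT av]] [ea]; [rewrite ea ltnn in aT|rewrite av].
- apply/measurable_EFinP; apply: measurable_funM => //.
  exact: (measurableT_comp (mprod T.+1 T _) measurable_fst).
- by move=> z; rewrite lee_fin mulr_ge0 ?expR_ge0.
- apply/measurable_EFinP; apply: measurable_funM; first exact: mprod.
  by apply: measurableT_comp => //; apply: measurable_funM => //; exact: (measurableT_comp mQ mxh).
- move=> w; rewrite /psi /=.
  under eq_integral do rewrite EFinM.
  rewrite ge0_integralZl_EFin//.
  + rewrite big_ord_recr /= EFinM -muleA EFinM lee_wpmul2l ?lee_fin ?prod0//.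
    exact: Hq.
  + apply/measurable_EFinP; apply: (Hist_measurable_fun mY (Q := now_subgrads T)).
    exact: (measurableT_comp mQn (@pair1_measurable _ _
      (History (past_values T)) (History (now_subgrads T)) w)).
  + exact: prod0.
Qed.

Lemma prob_gt_le (W : O -> R) (m k : R) : measurable_fun setT W -> (forall w, 0 <= W w) ->
  (\int[P]_w (W w)%:E <= m%:E)%E -> 0 < k -> (P [set w | k < W w]%R <= (m / k)%:E)%E.
Proof.
move=> mW W0 Wm k0; have [m' hm le_m] := ge0_has_mean mW W0 Wm.
have mS : measurable [set w | (k < W w)%R] by exact: measurable_set_lt.
rewrite -[X in P X]setIT -integral_indic//.
apply: (@le_trans _ _ (k^-1 * m')%:E); last by rewrite lee_fin mulrC ler_pM2r ?invr_gt0.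
apply: (integral_le_mean _ (has_meanZ k^-1 hm)) => [|w]; first exact: measurable_indic.
rewrite indicE; have [kW|_] := boolP (w \in _).
  rewrite ler01 /= mulrC ler_pdivlMr// mul1r ltW//.
  by move: kW; rewrite inE.
by rewrite lexx mulr_ge0// invr_ge0 ltW.
Qed.

Definition Bset (T : nat) (w : O) : seq nat := [seq t <- iota 0 T | bt t w].
Definition xbar (T : nat) (w : O) : 'rV[R]_d :=
  (size (Bset T w))%:R^-1 *: \sum_(t <- Bset T w) xt t w.

Lemma jensen_le (h : 'rV[R]_d -> R) (T : nat) (w : O) (b : R) :
  (forall x, exists2 v, enorm v <= M & is_subgrad h x v) -> (0 < size (Bset T w))%N ->
  (forall t, t \in Bset T w -> h (xt t w) <= b) -> h (xbar T w) <= b.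
Proof.
move=> H B0 hb; have nB0 : (0 : R) < (size (Bset T w))%:R by rewrite ltr0n.
have J := @jensen h (Bset T w) (fun t => xt t w) H B0.
rewrite -(ler_pM2l nB0); apply: (le_trans J).
rewrite mulr_natl -(count_predT (Bset T w)) -iter_addr_0 -big_const_seq.
by rewrite big_seq [leRHS]big_seq; apply: ler_sum => t /hb.
Qed.

(** * Accuracy of the constraint values along the trajectory *)

Section Accuracy.
Variables (sigma eps : R).
Hypothesis sigma_gt0 : 0 < sigma.
Hypothesis eps_gt0 : 0 < eps.
Hypothesis Nfv_gt0 : (0 < Nfv)%N.
Hypothesis gs_mean : forall i x, has_mean (D i) (gs i x) (G i x).
Hypothesis gs_subgauss : forall i x,
  (\int[D i]_w (expR ((gs i x w - G i x) ^+ 2 / sigma ^+ 2))%:E <= (expR 1)%:E)%E.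

(** The query point [xt t] is random, but it is determined by earlier iterations and thus
    independent of the value samples of time [t]. Once it is frozen, the tail bound at a fixed point
    applies. *)
Lemma inaccurate_prob t :
  measurable [set w | eps < `|ghat w t (xt t w) - gbar (xt t w)|] /\
  (P [set w | (eps < `|ghat w t (xt t w) - gbar (xt t w)|)%R] <=
   (2 * expR (- (n%:R * Nfv%:R * eps ^+ 2 / (24 * sigma ^+ 2))))%:E)%E.
Proof.
have mgx i x : measurable_fun setT (gs i x).
  exact: (measurableT_comp (mgs i) (@pair1_measurable _ _ (VecM R d) X x)).
have [mx _] := state_measurable t.
have mind dT (T : measurableType dT) (h : T -> R) : measurable_fun setT h ->
    measurable_fun setT (fun a => if eps < `|h a| then 1 else 0 : R).
  move=> mh; apply: measurable_fun_ifT => //; apply: measurable_fun_ltr => //.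
  exact: measurableT_comp.
have merr : measurable_fun setT (fun z : History (past t) * History (now_values t) =>
    ghat z.2 t (xt t z.1) - gbar (xt t z.1)).
  apply: measurable_funB; last first.
    exact: (measurableT_comp measurable_gbar (measurableT_comp mx measurable_fst)).
  apply: (@measurable_ghat _ (History (past t) * History (now_values t))%type
    (fun z => xt t z.1) snd).
    exact: (measurableT_comp mx measurable_fst).
  move=> i k; apply: (measurableT_comp (zeta_measurable _) measurable_snd).
  by split.
have merrP : measurable_fun setT (fun w => ghat w t (xt t w) - gbar (xt t w)).
  have [mx' _ mg _] := past_values_measurable t.
  apply: (Hist_measurable_fun mY (Q := past_values t)); apply: measurable_funB mg _.
  exact: (measurableT_comp measurable_gbar mx').
have mS : measurable [set w | eps < `|ghat w t (xt t w) - gbar (xt t w)|].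
  exact: (measurable_set_lt eps (measurableT_comp (@normr_measurable R setT) merrP)).
split => //.
pose psi (z : History (past t) * History (now_values t)) : \bar R :=
  (if eps < `|ghat z.2 t (xt t z.1) - gbar (xt t z.1)| then 1 else 0)%:E.
pose b := 2 * expR (- (n%:R * Nfv%:R * eps ^+ 2 / (24 * sigma ^+ 2))).
rewrite -[X in P X]setIT -integral_indic//.
rewrite [leLHS](_ : _ = \int[P]_w psi (w, w))%E; last first.
  apply: eq_integral => w _; rewrite /psi indicE /=; congr (_%:E).
  by case: ifPn => h; [rewrite mem_set|rewrite memNset//=; exact/negP].
apply: (@le_trans _ _ (\int[P]_w b%:E)%E).
  apply: (integral_freeze_le mY indep) => //.
  - by move=> s; rewrite /past /now_values /mkset => st [ts _]; rewrite ts ltnn in st.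
  - by apply/measurable_EFinP; exact: (mind _ _ _ merr).
  - by move=> z; rewrite lee_fin; case: ifP.
  - move=> w; rewrite /psi /=.
    have := ghat_err_tail n_gt0 xi_law zeta_law indep sigma_gt0 mgx gs_mean gs_subgauss
      t (xt t w) Nfv_gt0 eps_gt0.
    exact: le_trans.
by rewrite (integral_cst P measurableT b%:E) /= probability_setT mule1.
Qed.

(** Union bound over the iterations; its factor [T] is the source of [ln T] in the batch size. *)
Lemma accurate_prob (T : nat) : exists E : set O, [/\ measurable E,
  (P E <= (2 * T%:R * expR (- (n%:R * Nfv%:R * eps ^+ 2 / (24 * sigma ^+ 2))))%:E)%E &
  forall w, ~ E w -> forall t, (t < T)%N -> `|ghat w t (xt t w) - gbar (xt t w)| <= eps].
Proof.
elim: T => [|T [E [mE PE HE]]]; first by exists set0; split => //; rewrite measure0 mulr0 mul0r.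
have [mS PS] := inaccurate_prob T.
exists (E `|` [set w | eps < `|ghat w T (xt T w) - gbar (xt T w)|]); split.
- exact: measurableU.
- apply: le_trans (measureU2 _ mE mS) _.
  apply: (le_trans (leeD PE PS)); rewrite -EFinD lee_fin -natr1.
  set e := expR _; lra.
- move=> w /not_orP[nE nS] t; rewrite ltnS leq_eqVlt => /predU1P[->|]; last exact: HE.
  by rewrite leNgt; exact/negP.
Qed.

End Accuracy.

(* [r2] is the square of the radius, [l] stands for [1 + ln (1 / beta)], and [Bd] is the squared
   distance to [xstar] at which the second process is stopped. *)
Section Potentials.
Variables (eps r2 l w2 la Bd : R) (T : nat) (xstar : 'rV[R]_d).
Hypothesis eps_gt0 : 0 < eps.
Hypothesis eps_le_c : eps <= c.
Hypothesis T_gt0 : (0 < T)%N.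
Hypothesis r2_gt0 : 0 < r2.
Hypothesis l_ge1 : 1 <= l.
Hypothesis w2_gt0 : 0 < w2.
Hypothesis w2E : w2 = 256 * r2.
Hypothesis la_gt0 : 0 < la.
Hypothesis laE : la * (80 * r2) = 1.
Hypothesis BdE : Bd = 80 * (80 * r2) * l.
Hypothesis step_costE : step_cost = r2 / T%:R.
Hypothesis gamma_epsE : gamma * eps = l * step_cost.
Hypothesis xstar_feasible : gbar xstar <= 0.
Hypothesis x0_close : enorm (x0 - xstar) ^+ 2 <= r2.

Let TR : (0 : R) < T%:R. Proof. by rewrite ltr0n. Qed.
Let a_gt0 : 0 < step_cost. Proof. by rewrite step_costE divr_gt0. Qed.

Definition accurate t w := `|ghat w t (xt t w) - gbar (xt t w)| <= eps.
Definition pos_gap t w := if bt t w then Num.max (fbar (xt t w) - fbar xstar) 0 else 0.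

Lemma accurate_measurable t : measurable_fun setT (accurate t : History (past_values t) -> bool).
Proof.
have [mx _ mg _] := past_values_measurable t.
apply: measurable_fun_ler; last exact: measurable_cst.
apply: measurableT_comp => //; apply: measurable_funB mg _.
exact: (measurableT_comp measurable_gbar mx).
Qed.

Lemma pos_gap_measurable t : measurable_fun setT (pos_gap t : History (past_values t) -> R).
Proof.
have [mx _ _ mb] := past_values_measurable t.
apply: measurable_fun_ifT => //; apply: measurable_maxr; last exact: measurable_cst.
apply: measurable_funB; last exact: measurable_cst.
exact: (measurableT_comp measurable_fbar mx).
Qed.

Lemma gap_measurable t u : measurable_fun setT ((gap t)^~ u : History (past_values t) -> R).
Proof.
have [mx _ _ mb] := past_values_measurable t.
apply: measurable_fun_ifT => //; apply: measurable_funB; try exact: measurable_cst.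
  exact: (measurableT_comp measurable_fbar mx).
exact: (measurableT_comp measurable_gbar mx).
Qed.

(** * First potential: squared distance to the relaxed set *)

Definition relaxed : set 'rV[R]_d := [set u | fbar u <= fbar xstar /\ gbar u <= c + eps].
Definition dist_relaxed (x : 'rV[R]_d) : R := inf [set enorm (x - u) | u in relaxed].

Lemma relaxed_xstar : relaxed xstar.
Proof. by split => //; apply: le_trans xstar_feasible _; have := eps_gt0; have := eps_le_c; lra. Qed.

Lemma dist_relaxed_has_inf x : has_inf [set enorm (x - u) | u in relaxed].
Proof.
split; first by exists (enorm (x - xstar)), xstar => //; exact: relaxed_xstar.
by exists 0 => _ [u _ <-]; exact: enorm_ge0.
Qed.

Lemma dist_relaxed_le x u : relaxed u -> dist_relaxed x <= enorm (x - u).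
Proof. by move=> Ku; apply: ge_inf; [case: (dist_relaxed_has_inf x)|exists u]. Qed.

Lemma dist_relaxed_ge0 x : 0 <= dist_relaxed x.
Proof.
apply: lb_le_inf; first by case: (dist_relaxed_has_inf x).
by move=> _ [u _ <-]; exact: enorm_ge0.
Qed.

(** An almost nearest point stands in for the projection. The slack [eta] will be [step_cost], a
    loss that each step incurs anyway. *)
Lemma dist_relaxed_near x eta : 0 < eta ->
  exists2 u, relaxed u & enorm (x - u) ^+ 2 <= dist_relaxed x ^+ 2 + eta.
Proof.
move=> eta0; set m := dist_relaxed x; have m0 : 0 <= m := dist_relaxed_ge0 x.
have s0 : m < Num.sqrt (m ^+ 2 + eta).
  rewrite -{1}(ger0_norm m0) -sqrtr_sqr ltr_sqrt ?ltrDl//.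
  by rewrite ltr_wpDl// sqr_ge0.
have sm0 : 0 < Num.sqrt (m ^+ 2 + eta) - m by rewrite subr_gt0.
have [_ [u Ku <-]] := inf_adherent sm0 (dist_relaxed_has_inf x).
rewrite -/(dist_relaxed x) -/m => lt_u.
have {}lt_u : enorm (x - u) < Num.sqrt (m ^+ 2 + eta) by lra.
exists u => //.
rewrite -[leRHS]sqr_sqrtr; last by rewrite addr_ge0 ?sqr_ge0// ltW.
by rewrite ler_sqr ?nnegrE ?enorm_ge0 ?sqrtr_ge0// ltW.
Qed.

Lemma measurable_dist_relaxed : measurable_fun setT (dist_relaxed : VecM R d -> R).
Proof.
apply: (@measurable_lipschitz _ _ _ 1) => // x y; rewrite mul1r -lerBlDr.
apply: lb_le_inf; first by case: (dist_relaxed_has_inf y).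
move=> _ [u Ku <-]; rewrite lerBlDr; apply: le_trans (dist_relaxed_le x Ku) _.
by rewrite [leRHS]addrC; exact: ler_enormB.
Qed.

(* An accurate iterate at which [f] is followed although [f <= f xstar] lies in
   [relaxed], hence is close to every almost nearest point of [relaxed]. *)
Lemma gap_relaxed_ge t w u : accurate t w -> relaxed u ->
  enorm (xh t w - u) ^+ 2 <= dist_relaxed (xh t w) ^+ 2 + step_cost ->
  2 * gamma * pos_gap t w - 10 * step_cost - 4 * gamma * eps <= 2 * gamma * gap t w u.
Proof.
rewrite /accurate ler_norml => /andP[acc1 acc2] [fu gu] near.
have g0 : 0 < gamma by []. have a0 := a_gt0. have e0 : 0 < eps by [].
have ge0 : 0 < gamma * eps by exact: mulr_gt0.
rewrite /pos_gap /gap; case: ifPn => [b|nb]; last first.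
  have : c < ghat w t (xt t w) by rewrite ltNge.
  move=> cg; have : - (2 * eps) <= gbar (xt t w) - gbar u by lra.
  move=> /(ler_wpM2l (ltW g0)); nra.
have [fpos|fneg] := ltP (fbar xstar) (fbar (xt t w)).
  rewrite max_l ?subr_ge0 ?(ltW fpos)//.
  have : fbar (xt t w) - fbar xstar <= fbar (xt t w) - fbar u by lra.
  move=> /(ler_wpM2l (ltW g0)); nra.
rewrite max_r ?subr_le0// mulr0.
have Kx : relaxed (xt t w) by split => //; move: b; rewrite /bt => b; lra.
(* Half the bound on the distance from [xt] to [xh]. The point [u] is within [3 * rho] of [xh],
   hence within [5 * rho] of [xt], and Lipschitz continuity turns this into a loss of
   [5 * step_cost] before doubling. *)
pose rho := gamma * M / delta.
have rho0 : 0 <= rho by rewrite /rho divr_ge0 ?(ltW delta_gt0)// mulr_ge0// ltW.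
have rho2 : rho ^+ 2 = step_cost / delta by rewrite /rho /step_cost; field; rewrite gt_eqF.
have rhoM : gamma * (2 * M / delta) = 2 * rho by rewrite /rho; ring.
have h2 : gamma * (M * (5 * rho)) = 5 * step_cost.
  by rewrite /rho /step_cost; field; rewrite gt_eqF.
clearbody rho.
have xxh : enorm (xh t w - xt t w) <= 2 * rho.
  by rewrite enormC -rhoM; exact: xt_xh_le.
have d2 : dist_relaxed (xh t w) ^+ 2 <= (2 * rho) ^+ 2.
  rewrite ler_sqr ?nnegrE ?dist_relaxed_ge0 ?mulr_ge0//.
  exact: le_trans (dist_relaxed_le _ Kx) xxh.
have arho : step_cost <= rho ^+ 2.
  by rewrite rho2; apply: ler_peMr; [exact: ltW|rewrite invf_ge1].
have xhu : enorm (xh t w - u) <= 3 * rho.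
  rewrite -(@ler_pXn2r _ 2)// ?nnegrE ?enorm_ge0 ?mulr_ge0//.
  apply: (le_trans near); apply: (le_trans (lerD d2 arho)).
  by rewrite !exprMn; have := sqr_ge0 rho; lra.
have xu : enorm (xt t w - u) <= 5 * rho.
  by apply: le_trans (ler_enormB _ (xh t w) _) _; rewrite enormC; lra.
have lip := subgrad_lipschitz fbar_subgrad u (xt t w).
rewrite enormC in lip.
have h1 : M * enorm (xt t w - u) <= M * (5 * rho) by apply: ler_wpM2l.
have : - (M * (5 * rho)) <= fbar (xt t w) - fbar u by lra.
move=> /(ler_wpM2l (ltW g0)); lra.
Qed.

(* The weights decrease in [t] so as to absorb the quadratic variation of the
   noise, which is proportional to the squared distance itself. *)
Definition lamb (t : nat) : R := (2 - t%:R / T%:R) / w2.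
Definition slackb (t : nat) : R :=
  lamb t.+1 * (10 * step_cost + 4 * gamma * eps) +
  (lamb t * step_cost + 5 * step_cost * lamb t.+1 + 256 * lamb t.+1 ^+ 2 * step_cost ^+ 2).
(** The value 0 at an inaccurate step kills the product. The supermartingale inequality thus holds
    without conditioning, and accuracy is invoked pathwise at the end. *)
Definition facb (t : nat) (w : O) : R :=
  if accurate t w then expR (2 * gamma * lamb t.+1 * pos_gap t w - slackb t) else 0.

Let iw_gt0 : 0 < w2^-1. Proof. by rewrite invr_gt0. Qed.

Lemma lamb_bounds t : (t <= T)%N -> w2^-1 <= lamb t <= 2 / w2.
Proof.
move=> tT.
have h1 : t%:R / T%:R <= 1 :> R by rewrite ler_pdivrMr// mul1r ler_nat.
have h0 : 0 <= t%:R / T%:R :> R by rewrite divr_ge0// ?ler0n.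
by rewrite /lamb -[X in X <= _ <= _]mul1r !ler_pM2r//; apply/andP; split; lra.
Qed.

Lemma lamb_ge0 t : (t <= T)%N -> 0 <= lamb t.
Proof. by move=> /lamb_bounds/andP[l1 _]; exact: le_trans (ltW iw_gt0) l1. Qed.

(** The weights lose [w2^-1 / T] per step, while the noise asks for at most
    [64 * (2 / w2) ^+ 2 * r2 / T]. The value [w2 = 256 * r2] makes the two equal. *)
Lemma lamb_step t : (t < T)%N ->
  lamb t.+1 + 64 * lamb t.+1 ^+ 2 * step_cost <= lamb t.
Proof.
move=> tT; have /andP[l1 l2] := lamb_bounds tT.
have l0 := lamb_ge0 tT.
have -> : lamb t = lamb t.+1 + w2^-1 / T%:R.
  by rewrite /lamb -natr1; field; rewrite !gt_eqF.
rewrite lerD2l; apply: (@le_trans _ _ (64 * (2 / w2) ^+ 2 * step_cost)).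
  by rewrite ler_pM2r// ler_pM2l// ler_sqr ?nnegrE// (le_trans l0 l2).
have -> : w2^-1 / T%:R = w2^-1 ^+ 2 * (w2 / T%:R) by field; rewrite !gt_eqF.
have -> : w2 / T%:R = 256 * step_cost by rewrite step_costE w2E; ring.
rewrite le_eqVlt; apply/orP; left; apply/eqP; ring.
Qed.

Lemma slackb_le t : (t < T)%N -> slackb t <= 44 * l * (step_cost / w2).
Proof.
move=> tT; have /andP[l1 l2] := lamb_bounds tT.
have /andP[m1 m2] := lamb_bounds (ltnW tT).
have l0 := lamb_ge0 tT.
have a0 := a_gt0; have l_ge1' := l_ge1.
have ge : gamma * eps = l * step_cost by [].
have aw : 256 * step_cost <= w2.
  have : r2 / T%:R <= r2 by rewrite ler_pdivrMr// ler_peMr ?ler1n// ltW.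
  by rewrite step_costE w2E; lra.
rewrite /slackb; set a := step_cost in a0 ge aw *.
set i := a / w2.
have h1 : lamb t.+1 * a <= 2 * i.
  have -> : 2 * i = 2 / w2 * a by rewrite /i; ring.
  by apply: ler_wpM2r => //; exact: ltW.
have h2 : lamb t * a <= 2 * i.
  have -> : 2 * i = 2 / w2 * a by rewrite /i; ring.
  by apply: ler_wpM2r => //; exact: ltW.
have h0 : 0 <= lamb t.+1 * a by rewrite mulr_ge0// ltW.
have i256 : 256 * i <= 1 by rewrite /i mulrA ler_pdivrMr// mul1r.
have ii0 : 0 < i by rewrite /i divr_gt0.
clearbody i.
have -> : lamb t.+1 * (10 * a + 4 * gamma * eps) +
  (lamb t * a + 5 * a * lamb t.+1 + 256 * lamb t.+1 ^+ 2 * a ^+ 2) =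
  (lamb t.+1 * a) * (10 + 4 * l) + (lamb t * a + 5 * (lamb t.+1 * a) + 256 * (lamb t.+1 * a) ^+ 2).
  by rewrite -(mulrA 4) ge; ring.
have h3 : (lamb t.+1 * a) ^+ 2 <= (2 * i) ^+ 2.
  by rewrite !expr2; apply: ler_pM.
have h4 : (lamb t.+1 * a) * (10 + 4 * l) <= 2 * i * (10 + 4 * l) by apply: ler_wpM2r => //; lra.
have h5 : 256 * i * i <= 1 * i by apply: ler_wpM2r => //; exact: ltW.
have h6 : 1 * i <= l * i by apply: ler_wpM2r => //; exact: ltW.
set x := lamb t.+1 * a in h1 h3 h4 h0 *; set y := lamb t * a in h2 *.
rewrite exprMn expr2 in h3 *.
lra.
Qed.

Lemma facb_ge0 t w : 0 <= facb t w.
Proof. by rewrite /facb; case: ifP => // _; exact: expR_ge0. Qed.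

Lemma facb_measurable t : measurable_fun setT (facb t : History (past_values t) -> R).
Proof.
apply: measurable_fun_ifT => //; first exact: accurate_measurable.
apply: measurableT_comp => //; apply: measurable_funB; last exact: measurable_cst.
by apply: measurable_funM; [exact: measurable_cst|exact: pos_gap_measurable].
Qed.

(** The distance after the step is at most the distance to a point [u] of [relaxed] chosen before
    the step, almost nearest to [xh t w]; for this fixed [u] the one-step bound applies. *)
Lemma facb_step t w : (t < T)%N ->
  ((facb t w)%:E * \int[P]_w' (expR (lamb t.+1 * dist_relaxed (xnext t w w') ^+ 2))%:E <=
    (expR (lamb t * dist_relaxed (xh t w) ^+ 2))%:E)%E.
Proof.
move=> tT; rewrite /facb; case: ifP => [acc|_]; last by rewrite mul0e lee_fin expR_ge0.
have l0 := lamb_ge0 tT.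
have [u Ku near] := dist_relaxed_near (xh t w) a_gt0.
have gge := gap_relaxed_ge acc Ku near.
have mnext : measurable_fun setT (xnext t w : O -> VecM R d).
  apply: (Hist_measurable_fun mY (Q := now_subgrads t)).
  exact: (measurableT_comp (@xnext_measurable t) (@pair1_measurable _ _
      (History (past_values t)) (History (now_subgrads t)) w)).
have h : (\int[P]_w' (expR (lamb t.+1 * dist_relaxed (xnext t w w') ^+ 2))%:E <=
    \int[P]_w' (expR (lamb t.+1 * enorm (xnext t w w' - u) ^+ 2))%:E)%E.
  apply: ge0_le_integral => //.
  - apply/measurable_EFinP; apply: measurableT_comp => //; apply: measurable_funM => //.
    apply: measurable_funX; exact: (measurableT_comp measurable_dist_relaxed mnext).
  - apply/measurable_EFinP; apply: measurableT_comp => //; apply: measurable_funM => //.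
    under eq_fun do rewrite enorm_sqr.
    by apply: measurable_dotv; apply: measurable_vecB => //; exact: measurable_cst.
  - move=> w' _; rewrite lee_fin ler_expR ler_wpM2l// ler_sqr ?nnegrE ?dist_relaxed_ge0 ?enorm_ge0//.
    exact: dist_relaxed_le.
apply: (@le_trans _ _ ((expR (2 * gamma * lamb t.+1 * pos_gap t w - slackb t))%:E *
   (expR (lamb t.+1 * (enorm (xh t w - u) ^+ 2 - 2 * gamma * gap t w u + 5 * step_cost) +
    64 * lamb t.+1 ^+ 2 * step_cost * enorm (xh t w - u) ^+ 2 +
    256 * lamb t.+1 ^+ 2 * step_cost ^+ 2))%:E)%E).
  rewrite lee_wpmul2l ?lee_fin ?expR_ge0//.
  exact: (le_trans h (step_mgf t w u l0)).
rewrite -EFinM lee_fin -expRD ler_expR.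
have st := lamb_step tT.
set V := enorm _ ^+ 2 in near *; set Q := dist_relaxed _ ^+ 2 in near *.
have V0 : 0 <= V by exact: sqr_ge0.
have h1 := ler_wpM2r V0 st.
have lt0 := lamb_ge0 (ltnW tT).
have h2 := ler_wpM2l lt0 near.
have h3 := ler_wpM2l l0 gge.
rewrite /slackb; set a := step_cost in h1 h2 h3 *.
lra.
Qed.

Lemma pos_gap_event (b : R) : 0 < b -> - ln b <= l -> exists E : set O,
  [/\ measurable E, (P E <= b%:E)%E &
  forall w, ~ E w -> (forall t, (t < T)%N -> accurate t w) ->
    2 * gamma * (\sum_(t < T) pos_gap t w) <= 302 * l * r2].
Proof.
move=> b0 bl.
pose W w := \prod_(s < T) facb s w * expR (lamb T * dist_relaxed (xh T w) ^+ 2).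
have mQ : measurable_fun setT ((fun x => dist_relaxed x ^+ 2) : VecM R d -> R).
  by apply: measurable_funX; exact: measurable_dist_relaxed.
have IW : (\int[P]_w (W w)%:E <= (expR (lamb 0 * r2))%:E)%E.
  have := @exp_supermartingale (fun x => dist_relaxed x ^+ 2) (fun t _ => lamb t) facb (lamb 0) T
    mQ (fun _ => erefl) (fun _ => measurable_cst _) facb_measurable facb_ge0
    (fun t w tT => facb_step w tT).
  move/le_trans; apply; rewrite lee_fin ler_expR ler_wpM2l//.
    exact: lamb_ge0.
  apply: le_trans x0_close; rewrite ler_sqr ?nnegrE ?dist_relaxed_ge0 ?enorm_ge0//.
  exact/dist_relaxed_le/relaxed_xstar.
have mW : measurable_fun setT W.
  have [_ mxh _ _] := past_values_measurable T.
  apply: measurable_funM.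
    apply: measurable_prod => s _; apply: (Hist_measurable_fun mY (Q := past_values s)).
    exact: facb_measurable.
  apply: measurableT_comp => //; apply: measurable_funM => //.
  exact: (measurableT_comp mQ (Hist_measurable_fun mY mxh)).
have W0 w : 0 <= W w by rewrite mulr_ge0 ?expR_ge0// prodr_ge0// => s _; exact: facb_ge0.
(* Markov threshold, exceeded with probability at most [b]. *)
pose k := expR (lamb 0 * r2) / b.
have k0 : 0 < k by rewrite divr_gt0// expR_gt0.
exists [set w | k < W w]; split.
- exact: measurable_set_lt.
- apply: le_trans (prob_gt_le mW W0 IW k0) _.
  by rewrite lee_fin /k invf_div mulrC mulfVK// gt_eqF// expR_gt0.
- move=> w /negP; rewrite -leNgt => Wk acc.
  have prodE : \prod_(s < T) facb s w =
     expR (\sum_(s < T) (2 * gamma * lamb s.+1 * pos_gap s w - slackb s)).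
    rewrite expR_sum; apply: eq_bigr => s _.
    by rewrite /facb acc.
  have e1 : expR (\sum_(s < T) (2 * gamma * lamb s.+1 * pos_gap s w - slackb s)) <= k.
    apply: le_trans Wk; rewrite /W prodE ler_peMr ?expR_ge0// -expR0 ler_expR.
    by apply: mulr_ge0; [exact: lamb_ge0|exact: sqr_ge0].
  have {}e1 : \sum_(s < T) (2 * gamma * lamb s.+1 * pos_gap s w - slackb s) <= lamb 0 * r2 - ln b.
    rewrite -ler_expR; apply: (le_trans e1).
    by rewrite expRD expRN lnK.
  rewrite sumrB in e1.
  have e2 : \sum_(s < T) slackb s <= 44 * l * (r2 / w2).
    apply: (@le_trans _ _ (\sum_(s < T) 44 * l * (step_cost / w2))).
      by apply: ler_sum => s _; exact: slackb_le.
    rewrite sumr_const card_ord -[leLHS]mulr_natr step_costE le_eqVlt.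
    by apply/orP; left; apply/eqP; field; rewrite !gt_eqF.
  have e3 : 2 * gamma * (\sum_(t < T) pos_gap t w) / w2 <=
      \sum_(s < T) 2 * gamma * lamb s.+1 * pos_gap s w.
    rewrite mulr_sumr mulr_suml; apply: ler_sum => s _.
    have p0 : 0 <= pos_gap s w by rewrite /pos_gap; case: ifP => // _; rewrite le_max lexx orbT.
    rewrite mulrAC; apply: ler_wpM2r => //; apply: ler_wpM2l.
      by rewrite mulr_ge0// ltW.
    by have /andP[] := lamb_bounds (ltn_ord s).
  have e4 : lamb 0 * r2 = 2 * (r2 / w2) by rewrite /lamb mul0r subr0; ring.
  have e5 : 2 * gamma * (\sum_(t < T) pos_gap t w) / w2 <= (2 + 44 * l) * (r2 / w2) + l.
    by rewrite e4 in e1; lra.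
  (* Origin of the constant: [2 + 44 * l + 256 * l <= 302 * l]. *)
  have e6 : ((2 + 44 * l) * (r2 / w2) + l) * w2 = (2 + 44 * l) * r2 + l * (256 * r2).
    by rewrite -w2E; field; rewrite gt_eqF.
  rewrite ler_pdivrMr// e6 in e5.
  apply: (le_trans e5); have : r2 <= l * r2 by rewrite ler_peMl// ltW.
  lra.
Qed.

(** * Second potential: stopped squared distance to the optimum *)

Definition sqdist (x : 'rV[R]_d) : R := enorm (x - xstar) ^+ 2.

Fixpoint alive (t : nat) (w : O) : bool :=
  match t with
  | 0 => sqdist (xh 0 w) <= Bd
  | t'.+1 => alive t' w && (sqdist (xh t w) <= Bd)
  end.

(** At the exit time itself the rate is still [la], so that the product records the exit distance;
    it vanishes from the next time on. *)
Definition ella (t : nat) (w : O) : R :=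
  if t is t'.+1 then if alive t' w then la else 0 else la.
Definition slacka : R :=
  5 * step_cost * la + 64 * la ^+ 2 * step_cost * Bd + 256 * la ^+ 2 * step_cost ^+ 2.
(* Once the iterate has left the ball the process is frozen. *)
Definition faca (t : nat) (w : O) : R :=
  if alive t w then expR (2 * la * gamma * gap t w xstar - slacka)
  else expR (ella t w * sqdist (xh t w)).

Lemma alive_sqdist t w : alive t w -> sqdist (xh t w) <= Bd.
Proof. by case: t => // t /andP[]. Qed.

Lemma alive_mono s t w : (s <= t)%N -> alive t w -> alive s w.
Proof.
move=> /subnK <-; elim: (t - s)%N => // k IH; rewrite addSn => /andP[h _].
exact: IH.
Qed.

Lemma sqdist_measurable : measurable_fun setT (sqdist : VecM R d -> R).
Proof.
rewrite /sqdist; under eq_fun do rewrite enorm_sqr.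
by apply: measurable_dotv; apply: measurable_vecB => //; exact: measurable_cst.
Qed.

Lemma alive_measurable t : measurable_fun setT (alive t : History (past_values t) -> bool).
Proof.
have mle s : measurable_fun setT
    ((fun w => sqdist (xh s w) <= Bd) : History (past_values s) -> bool).
  have [_ mxh _ _] := past_values_measurable s.
  apply: measurable_fun_ler; last exact: measurable_cst.
  exact: (measurableT_comp sqdist_measurable mxh).
elim: t => [|t IH]; first exact: mle.
by apply: measurable_and => //; exact: (HistS (past_values_mono (leqnSn t)) IH).
Qed.

Lemma ella_measurable t : measurable_fun setT (ella t.+1 : History (past_values t) -> R).
Proof.
by apply: measurable_fun_ifT; [exact: alive_measurable|exact: measurable_cst|exact: measurable_cst].
Qed.

Lemma faca_measurable t : measurable_fun setT (faca t : History (past_values t) -> R).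
Proof.
have [_ mxh _ _] := past_values_measurable t.
apply: measurable_fun_ifT; first exact: alive_measurable.
  apply: measurableT_comp => //; apply: measurable_funB; last exact: measurable_cst.
  by apply: measurable_funM; [exact: measurable_cst|exact: gap_measurable].
apply: measurableT_comp => //; apply: measurable_funM; last first.
  exact: (measurableT_comp sqdist_measurable mxh).
case: t {mxh} => [|t]; first exact: measurable_cst.
exact: (HistS (past_values_mono (leqnSn t)) (@ella_measurable t)).
Qed.

Lemma faca_ge0 t w : 0 <= faca t w.
Proof. by rewrite /faca; case: ifP => _; exact: expR_ge0. Qed.

Lemma alive_ella t w : alive t w -> ella t w = la.
Proof. by case: t => // t /= /andP[-> _]. Qed.

Lemma faca_step t w :
  ((faca t w)%:E * \int[P]_w' (expR (ella t.+1 w * sqdist (xnext t w w')))%:E <=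
    (expR (ella t w * sqdist (xh t w)))%:E)%E.
Proof.
rewrite /faca /=; case: ifPn => [al|_]; last first.
  under eq_integral do rewrite mul0r expR0.
  by rewrite (integral_cst P measurableT 1%:E) /= probability_setT mule1 mule1.
rewrite (alive_ella al).
have := step_mgf t w xstar (ltW la_gt0); rewrite -/(sqdist _) => h.
apply: le_trans (lee_wpmul2l _ h) _; first by rewrite lee_fin expR_ge0.
rewrite -EFinM lee_fin -expRD ler_expR /slacka.
have c0 : 0 <= 64 * la ^+ 2 * step_cost.
  by apply: mulr_ge0; [apply: mulr_ge0 => //; exact: sqr_ge0|exact: ltW].
have := ler_wpM2l c0 (alive_sqdist al).
set V := sqdist _; set a := step_cost; lra.
Qed.

Lemma prod_faca_alive w k : (forall s, (s < k)%N -> alive s w) ->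
  \prod_(0 <= s < k) faca s w =
  expR (2 * la * gamma * (\sum_(0 <= s < k) gap s w xstar) - k%:R * slacka).
Proof.
move=> al.
have -> : 2 * la * gamma * (\sum_(0 <= s < k) gap s w xstar) - k%:R * slacka =
    \sum_(0 <= s < k) (2 * la * gamma * gap s w xstar - slacka).
  by rewrite sumrB mulr_sumr sumr_const_nat subn0 -[slacka *+ k]mulr_natl.
by rewrite expR_sum; apply: eq_big_nat => s /andP[_ sk]; rewrite /faca al.
Qed.

(** With [la * (80 * r2) = 1] the term in [Bd] sums to at most [64 * l]. The other two are at most
    [5 / 80] and [256 / 6400], which fit into [9 / 80]. *)
Lemma slacka_le k : (k <= T)%N -> k%:R * slacka <= 64 * l + 9 / 80.
Proof.
move=> kT; have a0 := a_gt0; have l0 := la_gt0; have r0 := r2_gt0.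
have l1 : 1 <= l := l_ge1.
have B0 : 0 <= Bd.
  rewrite BdE; apply: mulr_ge0; last lra.
  by apply: mulr_ge0 => //; apply: mulr_ge0 => //; exact: ltW.
have s0 : 0 <= slacka.
  rewrite /slacka; apply: addr_ge0; first apply: addr_ge0.
  - by apply: mulr_ge0; [apply: mulr_ge0|] => //; exact: ltW.
  - apply: mulr_ge0 => //; apply: mulr_ge0; [apply: mulr_ge0 => //; exact: sqr_ge0|exact: ltW].
  - rewrite -mulrA; apply: mulr_ge0; first exact: ler0n.
    by apply: mulr_ge0; exact: sqr_ge0.
apply: (@le_trans _ _ (T%:R * slacka)).
  by apply: ler_wpM2r => //; rewrite ler_nat.
have aT : T%:R * step_cost = r2 by rewrite step_costE; field; rewrite gt_eqF.
have aler : step_cost <= r2 by rewrite step_costE ler_pdivrMr// ler_peMr ?ler1n// ltW.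
pose m := la * r2.
have mE : 80 * m = 1 by rewrite /m mulrCA laE.
have -> : T%:R * slacka = 5 * m + 64 * (80 * m) * (80 * m) * l + 256 * m * (la * step_cost).
  rewrite /slacka BdE; set a := step_cost in aT *.
  transitivity (5 * la * (T%:R * a) + 64 * la ^+ 2 * (T%:R * a) * (80 * (80 * r2) * l)
    + 256 * la ^+ 2 * (T%:R * a) * a); first by ring.
  by rewrite aT /m; ring.
have : la * step_cost <= m by rewrite /m; apply: ler_wpM2l => //; exact: ltW.
have m0 : 0 <= m by rewrite /m; apply: mulr_ge0; exact: ltW.
move=> /(ler_wpM2l m0); rewrite mE; nra.
Qed.

Lemma gap_event (b : R) : 0 < b -> - ln b <= l -> exists E : set O,
  [/\ measurable E, (P E <= b%:E)%E &
  forall w, ~ E w ->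
    2 * gamma * (\sum_(0 <= s < T) gap s w xstar) <= 65 * (80 * r2) * l + 10 * r2 \/
    exists2 k, (k < T)%N & 2 * gamma * (\sum_(0 <= s < k) gap s w xstar) <=
      65 * (80 * r2) * l + 10 * r2 - Bd].
Proof.
move=> b0 bl; have l0 := la_gt0.
pose W w := \prod_(s < T) faca s w * expR (ella T w * sqdist (xh T w)).
have IW : (\int[P]_w (W w)%:E <= (expR (la * r2))%:E)%E.
  have := @exp_supermartingale sqdist ella faca la T
    sqdist_measurable (fun _ => erefl) ella_measurable faca_measurable faca_ge0
    (fun t w _ => faca_step t w).
  move/le_trans; apply; rewrite lee_fin ler_expR; apply: ler_wpM2l; first exact: ltW.
  exact: x0_close.
have mW : measurable_fun setT W.
  have [_ mxh _ _] := past_values_measurable T.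
  apply: measurable_funM.
    apply: measurable_prod => s _; apply: (Hist_measurable_fun mY (Q := past_values s)).
    exact: faca_measurable.
  apply: measurableT_comp => //; apply: measurable_funM => //.
    case: (T) {mxh} => [|t]; first exact: measurable_cst.
    exact: (Hist_measurable_fun mY (@ella_measurable t)).
  exact: (measurableT_comp sqdist_measurable (Hist_measurable_fun mY mxh)).
have W0 w : 0 <= W w by rewrite mulr_ge0 ?expR_ge0// prodr_ge0// => s _; exact: faca_ge0.
pose k := expR (la * r2) / b.
have k0 : 0 < k by rewrite divr_gt0// expR_gt0.
have kE : k = expR (la * r2 - ln b) by rewrite expRD expRN lnK.
exists [set w | k < W w]; split.
- exact: measurable_set_lt.
- apply: le_trans (prob_gt_le mW W0 IW k0) _.
  by rewrite lee_fin /k invf_div mulrC mulfVK// gt_eqF// expR_gt0.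
move=> w /negP; rewrite -leNgt => Wk.
(* Common end of both cases: [x = 0] without exit, [x = Bd] with exit. Division by [la] turns
   [l + 64 * l] into [65 * (80 * r2) * l], and [la * r2 + 9 / 80] into [10 * r2]. *)
have concl j x : (j <= T)%N ->
    2 * la * gamma * (\sum_(0 <= s < j) gap s w xstar) - j%:R * slacka + la * x <= la * r2 - ln b ->
    2 * gamma * (\sum_(0 <= s < j) gap s w xstar) <= 65 * (80 * r2) * l + 10 * r2 - x.
  move=> jT h; have hs := slacka_le jT.
  rewrite -(ler_pM2l l0).
  have m1 : la * r2 = 80^-1.
    by apply: (@mulfI _ 80) => //; rewrite mulrCA laE mulfV.
  have -> : la * (65 * (80 * r2) * l + 10 * r2 - x) =
    65 * (la * (80 * r2)) * l + 10 * (la * r2) - la * x by ring.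
  rewrite laE m1 in h *.
  have l1 : 1 <= l := l_ge1.
  set S := \sum_(0 <= s < j) _ in h *; lra.
have [dead|nodead] := pselect (exists s, (s < T)%N && ~~ alive s w).
  right; have [j /andP[jT dj] jmin] := ex_minnP dead.
  have alj s : (s < j)%N -> alive s w.
    move=> sj; apply: contraT => ds.
    by have := jmin s; rewrite ds (ltn_trans sj jT) leqNgt sj => /(_ isT).
  exists j => //; apply: concl (ltnW jT) _.
  have elj : ella j w = la.
    by case: j {dj jT jmin} alj => // j alj; rewrite /ella alj.
  have dlt : Bd < sqdist (xh j w).
    case: j dj {jT jmin elj} alj => [|j] /=; first by rewrite ltNge.
    by move=> + alj; rewrite alj//= -ltNge.
  have after s : (j < s)%N -> ella s w = 0.
    case: s => // s; rewrite ltnS => js; rewrite /ella ifN//.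
    by apply: contra dj; exact: alive_mono.
  (* All factors after the exit time [j] are 1, so [W] retains the product up to [j], whose last
     factor exceeds [expR (la * Bd)]. *)
  move: Wk; rewrite /W -(big_mkord xpredT (fun s => faca s w)) after// mul0r expR0 mulr1.
  rewrite (@big_cat_nat _ _ _ j.+1)//= big_nat_recr//= prod_faca_alive//.
  rewrite [X in _ * X <= _]big1_seq ?mulr1.
    rewrite {1}/faca (negbTE dj) elj -expRD kE ler_expR.
    move: dlt => /ltW /(ler_wpM2l (ltW l0)); lra.
  move=> s /=; rewrite mem_index_iota => /andP[js _].
  rewrite /faca ifN ?after// ?mul0r ?expR0//.
  by apply: contra dj; apply: alive_mono; exact: ltnW.
left.
have al s : (s < T)%N -> alive s w.
  by move=> sT; apply: contraT => ds; exfalso; apply: nodead; exists s; rewrite sT.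
rewrite -[leRHS]subr0; apply: concl => //.
rewrite mulr0 addr0 -ler_expR -kE -prod_faca_alive//.
apply: le_trans Wk; rewrite /W -(big_mkord xpredT (fun s => faca s w)).
rewrite ler_peMr//; first by apply: prodr_ge0 => s _; exact: faca_ge0.
rewrite -expR0 ler_expR mulr_ge0 ?sqr_ge0//.
by case: (T) => [|t] /=; [exact: ltW|case: ifP => // _; exact: ltW].
Qed.

(** * From the two potentials to the averaged iterate *)

Variable K : R.
Hypothesis KE : K = 65 * 80 + 10.
Hypothesis cE : c = (K + 1) * eps.

Let fgap w t := fbar (xt t w) - fbar xstar.

Lemma Bset_sum w k (h : nat -> R) :
  \sum_(t <- [seq t <- iota 0 k | bt t w]) h t = \sum_(0 <= t < k | bt t w) h t.
Proof. by rewrite big_filter /index_iota subn0. Qed.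

(** Outside B the observed value exceeds [c], so by accuracy such a step contributes at least
    [c - eps] to the sum. *)
Lemma sum_gap_ge w k : (forall t, (t < T)%N -> accurate t w) -> (k <= T)%N ->
  \sum_(0 <= t < k | bt t w) fgap w t + (c - eps) * (k%:R - (size [seq t <- iota 0 k | bt t w])%:R) <=
  \sum_(0 <= t < k) gap t w xstar.
Proof.
move=> acc kT; rewrite [leRHS](bigID (fun t => bt t w)) /=; apply: lerD.
  by rewrite le_eqVlt; apply/orP; left; apply/eqP/eq_bigr => t bt'; rewrite /gap bt'.
have -> : (c - eps) * (k%:R - (size [seq t <- iota 0 k | bt t w])%:R) =
    \sum_(0 <= t < k | ~~ bt t w) (c - eps).
  rewrite big_const_seq iter_addr_0 -[RHS]mulr_natr /index_iota subn0; congr (_ * _).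
  rewrite size_filter -[k in X in X - _](size_iota 0) -(count_predC (fun t => bt t w)).
  by rewrite natrD addrC addKr.
rewrite [leLHS]big_nat_cond [leRHS]big_nat_cond; apply: ler_sum => t /andP[/andP[_ tk] nb].
rewrite /gap (negbTE nb).
have := acc t (leq_trans tk kT); rewrite /accurate ler_norml => /andP[_].
by move: nb; rewrite /bt -ltNge; have := xstar_feasible; lra.
Qed.

Lemma trajectory_conclusion w : (forall t, (t < T)%N -> accurate t w) ->
  2 * gamma * (\sum_(t < T) pos_gap t w) <= 302 * l * r2 ->
  (2 * gamma * (\sum_(0 <= s < T) gap s w xstar) <= 65 * (80 * r2) * l + 10 * r2 \/
    exists2 k, (k < T)%N & 2 * gamma * (\sum_(0 <= s < k) gap s w xstar) <=
      65 * (80 * r2) * l + 10 * r2 - Bd) ->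
  [/\ (0 < size (Bset T w))%N, fbar (xbar T w) - fbar xstar <= K * eps &
      gbar (xbar T w) <= c + eps].
Proof.
move=> acc hpos hgap.
have g0 : 0 < gamma by [].
have E0 : 0 < gamma * eps by apply: mulr_gt0.
have rE : l * r2 = gamma * eps * T%:R.
  by rewrite gamma_epsE step_costE; field; rewrite gt_eqF.
have rle : r2 <= l * r2 by rewrite ler_peMl// ltW.
have K0 : 0 < K by rewrite KE; lra.
set SB := \sum_(0 <= t < T | bt t w) fgap w t.
have SBE : \sum_(t <- Bset T w) fgap w t = SB by exact: Bset_sum.
have nil0 : size (Bset T w) = 0%N -> SB = 0.
  by move=> /size0nil Bn; rewrite -SBE Bn big_nil.
have main : (0 < size (Bset T w))%N /\ gamma * SB <= K * (gamma * eps) * (size (Bset T w))%:R.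
  case: hgap => [hT|[k kT hk]].
    have := sum_gap_ge acc (leqnn T); rewrite -/SB -/(Bset T w).
    set nB := (size (Bset T w))%:R : R; set S := \sum_(0 <= t < T) _ in hT *.
    have -> : c - eps = K * eps by rewrite cE; ring.
    move=> /(ler_wpM2l (ltW g0)) hS.
    (* Each step outside B contributes [c - eps = K * eps], but the bound on the sum of gaps only
       allows for [T / 2] such steps. This forces B to be nonempty. *)
    have key : 2 * (gamma * SB) <= K * (gamma * eps) * (2 * nB - T%:R).
      have h1 : 2 * gamma * S <= K * (gamma * eps) * T%:R.
        apply: (le_trans hT); rewrite KE.
        have -> : (65 * 80 + 10) * (gamma * eps) * T%:R = (65 * 80 + 10) * (l * r2) by rewrite rE; ring.
        lra.
      have h2 : gamma * (SB + K * eps * (T%:R - nB)) =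
        gamma * SB + K * (gamma * eps) * T%:R - K * (gamma * eps) * nB by ring.
      rewrite h2 in hS.
      have -> : K * (gamma * eps) * (2 * nB - T%:R) =
        2 * (K * (gamma * eps) * nB) - K * (gamma * eps) * T%:R by ring.
      rewrite -mulrA in h1; lra.
    have KET : 0 < K * (gamma * eps) * T%:R by rewrite !mulr_gt0.
    split.
      rewrite lt0n; apply/negP => /eqP B0.
      by move: key; rewrite /nB B0 nil0//; lra.
    by move: key; lra.
  (* Up to the exit time [k] the gaps are kept; later ones are replaced by their positive parts. *)
  have hS : gamma * SB <= gamma * (\sum_(0 <= s < k) gap s w xstar) + gamma * (\sum_(t < T) pos_gap t w).
    rewrite -mulrDr ler_pM2l// /SB (@big_cat_nat _ _ _ k)//=; last exact: ltnW.
    apply: lerD.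
      apply: le_trans (sum_gap_ge acc (ltnW kT)); rewrite lerDl mulr_ge0//.
        by rewrite subr_ge0.
      rewrite subr_ge0 ler_nat size_filter; apply: leq_trans (count_size _ _) _.
      by rewrite size_iota.
    have pos0 t : 0 <= pos_gap t w.
      by rewrite /pos_gap; case: ifP => // _; rewrite le_max lexx orbT.
    rewrite -(big_mkord xpredT (fun t => pos_gap t w)) (@big_cat_nat _ _ _ k 0 T)//=; last exact: ltnW.
    apply: ler_wpDl; first by apply: sumr_ge0.
    rewrite big_mkcond; apply: ler_sum => t _; rewrite /pos_gap.
    by case: ifP => // _; rewrite le_max lexx.
  (* In units of [l * r2], the deficit at the exit is at least [(80 - 65) * 80 - 10 = 1190], more
     than the 302 of the positive parts. *)
  have neg : gamma * SB < 0.
    move: hS hpos hk; rewrite BdE.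
    set A := \sum_(0 <= s < k) _; set B := \sum_(t < T) _ => hS hpos hk.
    have lr0 : 0 < l * r2 by apply: lt_le_trans rle.
    have q1 : 2 * (gamma * B) <= 302 * (l * r2) by move: hpos; rewrite !mulrA.
    have q2 : 2 * (gamma * A) <= 65 * 80 * (l * r2) + 10 * r2 - 80 * 80 * (l * r2).
      move: hk; rewrite mulrA => hk; lra.
    lra.
  split.
    rewrite lt0n; apply/negP => /eqP B0.
    by move: neg; rewrite nil0// mulr0 ltxx.
  by apply: le_trans (ltW neg) _; rewrite !mulr_ge0// ltW.
have [B0 hB] := main.
have nB0 : (0 : R) < (size (Bset T w))%:R by rewrite ltr0n.
split => //.
- have := @jensen fbar (Bset T w) (fun t => xt t w) fbar_subgrad B0; rewrite -/(xbar T w).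
  have sumE : \sum_(t <- Bset T w) fbar (xt t w) = SB + (size (Bset T w))%:R * fbar xstar.
    rewrite -SBE sumrB big_const_seq count_predT iter_addr_0 -[fbar xstar *+ _]mulr_natl.
    by rewrite subrK.
  rewrite sumE => J.
  have J2 : gamma * (size (Bset T w))%:R * (fbar (xbar T w) - fbar xstar) <=
      gamma * (size (Bset T w))%:R * (K * eps).
    apply: (@le_trans _ _ (gamma * SB)).
      by rewrite -mulrA ler_pM2l// mulrBr; lra.
    by apply: (le_trans hB); rewrite le_eqVlt; apply/orP; left; apply/eqP; ring.
  by rewrite ler_pM2l ?mulr_gt0// in J2.
- apply: (jensen_le gbar_subgrad B0) => t; rewrite mem_filter mem_iota => /andP[b /andP[_ tT]].
  have := acc t tT; rewrite /accurate ler_norml => /andP[+ _].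
  by move: b; rewrite /bt; lra.
Qed.

(** The failure probability is split into [beta] for accuracy and [beta / 2] for each potential. *)
Lemma high_probability (sigma beta : R) : 0 < sigma -> (0 < Nfv)%N ->
  (forall i x, has_mean (D i) (gs i x) (G i x)) ->
  (forall i x, (\int[D i]_w (expR ((gs i x w - G i x) ^+ 2 / sigma ^+ 2))%:E <= (expR 1)%:E)%E) ->
  0 < beta -> - ln (beta / 2) <= l ->
  2 * T%:R * expR (- (n%:R * Nfv%:R * eps ^+ 2 / (24 * sigma ^+ 2))) <= beta ->
  exists E : set O, [/\ measurable E, ((1 - 2 * beta)%:E <= P E)%E &
    forall w, E w -> [/\ (0 < size (Bset T w))%N,
      fbar (xbar T w) - fbar xstar <= K * eps & gbar (xbar T w) <= c + eps]].
Proof.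
move=> s0 N0 gm gsg b0 bl tail.
have b20 : 0 < beta / 2 by rewrite divr_gt0.
have [E1 [m1 P1 H1]] := accurate_prob s0 eps_gt0 N0 gm gsg T.
have [E2 [m2 P2 H2]] := pos_gap_event b20 bl.
have [E3 [m3 P3 H3]] := gap_event b20 bl.
have m12 : measurable (E1 `|` E2) by exact: measurableU.
have mU : measurable (E1 `|` E2 `|` E3) by exact: measurableU.
have PU : (P (E1 `|` E2 `|` E3) <= (2 * beta)%:E)%E.
  apply: (le_trans (measureU2 _ m12 m3)).
  rewrite (_ : 2 * beta = (beta + beta / 2) + beta / 2); last by field.
  rewrite !EFinD; apply: leeD P3; apply: (le_trans (measureU2 _ m1 m2)).
  by apply: leeD P2; apply: le_trans P1 _; rewrite lee_fin.
exists (~` (E1 `|` E2 `|` E3)); split.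
- exact: measurableC.
- by rewrite probability_setC// EFinB; apply: leeB.
- move=> w /not_orP[/not_orP[n1 n2] n3].
  have acc := H1 w n1.
  exact: (trajectory_conclusion acc (H2 w n2 acc) (H3 w n3)).
Qed.

End Potentials.

(** * The degenerate case *)

Lemma xh_displacement t w : enorm (xh t w - x0) <= gamma * M * t%:R.
Proof.
elim: t => [|t IH]; first by rewrite xh_0 subrr enorm0 mulr0.
rewrite xh_S /xnext addrAC; apply: (le_trans (ler_enormD _ _)).
rewrite enormN enormZ ger0_norm ?(ltW gamma_gt0)// -natr1 mulrDr mulr1; apply: lerD => //.
by apply: ler_wpM2l; [exact: ltW|apply: enorm_avg_le => // i; exact: ht_le].
Qed.

(* For a tiny stepsize the trajectory stays next to [x0], which suffices when [M * rad <= 0]. *)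
Lemma degenerate_high_probability (sigma beta rad bnd : R) (T : nat) (xstar : 'rV[R]_d) :
  0 < sigma -> (0 < Nfv)%N -> (0 < T)%N ->
  (forall i x, has_mean (D i) (gs i x) (G i x)) ->
  (forall i x, (\int[D i]_w (expR ((gs i x w - G i x) ^+ 2 / sigma ^+ 2))%:E <= (expR 1)%:E)%E) ->
  0 < c -> 2 * expR (- (n%:R * Nfv%:R * c ^+ 2 / (24 * sigma ^+ 2))) <= 2 * beta ->
  gbar xstar <= 0 -> enorm (x0 - xstar) <= rad -> M * rad <= 0 ->
  gamma * M ^+ 2 * (T%:R + 2 / delta) <= bnd ->
  exists E : set O, [/\ measurable E, ((1 - 2 * beta)%:E <= P E)%E &
    forall w, E w -> [/\ (0 < size (Bset T w))%N,
      fbar (xbar T w) - fbar xstar <= bnd & gbar (xbar T w) <= bnd]].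
Proof.
move=> s0 N0 T0 gm gsg c0 tail gx hrad Mr hbnd.
(* Accuracy [c] at time 0 puts the time 0 into B; at all later times Lipschitz continuity controls
   [fbar] and [gbar]. *)
have [mE PE] := inaccurate_prob s0 c0 N0 gm gsg 0.
have Mx : M * enorm (x0 - xstar) <= 0 by apply: le_trans Mr; exact: ler_wpM2l.
have close t w : (t < T)%N -> M * enorm (xt t w - xstar) <= bnd.
  move=> tT; apply: le_trans hbnd.
  have h1 := xt_xh_le t w; have h2 := xh_displacement t w.
  have h3 : gamma * M * t%:R <= gamma * M * T%:R.
    by apply: ler_wpM2l; [apply: mulr_ge0 => //; exact: ltW|rewrite ler_nat ltnW].
  have h4 : enorm (xt t w - xstar) <= gamma * (2 * M / delta) + gamma * M * T%:R + enorm (x0 - xstar).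
    apply: (le_trans (ler_enormB _ x0 _)); rewrite lerD2r.
    by apply: (le_trans (ler_enormB _ (xh t w) _)); apply: lerD => //; exact: le_trans h2 h3.
  apply: (le_trans (ler_wpM2l M_ge0 h4)); rewrite mulrDr.
  have -> : M * (gamma * (2 * M / delta) + gamma * M * T%:R) = gamma * M ^+ 2 * (T%:R + 2 / delta).
    by ring.
  by rewrite gerDl.
exists (~` [set w | c < `|ghat w 0 (xt 0 w) - gbar (xt 0 w)|]); split.
- exact: measurableC.
- rewrite probability_setC// EFinB; apply: leeB => //.
  by apply: le_trans PE _; rewrite lee_fin.
move=> w /negP; rewrite -leNgt ler_norml => /andP[_ acc].
have lipg x := subgrad_lipschitz gbar_subgrad x xstar.
have lipf x := subgrad_lipschitz fbar_subgrad x xstar.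
have b0 : bt 0 w.
  rewrite /bt; have := lipg (xt 0 w); rewrite {2}/xt /=.
  by move: acc Mx gx; lra.
have B0 : (0 < size (Bset T w))%N.
  by rewrite size_filter -has_count; apply/hasP; exists 0%N => //; rewrite mem_iota.
split => //.
- rewrite lerBlDl; apply: (jensen_le fbar_subgrad B0) => t.
  rewrite mem_filter mem_iota => /andP[_ /andP[_ tT]].
  by apply: (le_trans (lipf _)); rewrite lerD2l; exact: close.
- apply: (jensen_le gbar_subgrad B0) => t.
  rewrite mem_filter mem_iota => /andP[_ /andP[_ tT]].
  by apply: (le_trans (lipg _)); rewrite -[leRHS]add0r; apply: lerD => //; exact: close.
Qed.
End Process.

(** * Choice of the parameters *)

Lemma ln2_le1 {R : realType} : ln 2 <= 1 :> R.
Proof.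
rewrite -[leRHS](@expRK R) ler_ln ?posrE ?expR_gt0//.
by have := expR_ge1Dx (1 : R); lra.
Qed.

(** A batch of size 1 is a single sample, so the case [N = 1] is a statement about [D i]. Larger
    batches and the average over workers then follow from independence. *)
Lemma batch_subgauss {R : realType} {d n : nat} {dO dX : measure_display}
  {O : measurableType dO} {X : measurableType dX} (P : probability O R)
  (D : 'I_n -> probability X R) (zeta : nat -> 'I_n -> nat -> O -> X)
  (gs : 'I_n -> 'rV[R]_d -> X -> R) (G : 'I_n -> 'rV[R]_d -> R) (sigma : R) :
  (forall i x, measurable_fun setT (gs i x)) ->
  (forall t i k, measurable_fun setT (zeta t i k) /\
    forall A, measurable A -> P (zeta t i k @^-1` A) = D i A) ->
  (forall (N t : nat) i x, (0 < N)%N ->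
    (\int[P]_w (expR ((batch_value gs zeta N t i x w - G i x) ^+ 2
       / (sigma ^+ 2 / N%:R)))%:E <= (expR 1)%:E)%E) ->
  forall i x, (\int[D i]_w (expR ((gs i x w - G i x) ^+ 2 / sigma ^+ 2))%:E <= (expR 1)%:E)%E.
Proof.
move=> mgs law H i x; apply: le_trans (H 1%N 0%N i x isT).
have mz (_ : unit) : measurable_fun setT (zeta 0 i 0) by have [] := law 0%N i 0%N.
have lawz := (law 0%N i 0%N).2.
have mphi : measurable_fun setT (fun z => (expR ((gs i x z - G i x) ^+ 2 / sigma ^+ 2))%:E).
  apply/measurable_EFinP; apply: measurableT_comp => //; apply: measurable_funM => //.
  by apply: measurable_funX; apply: measurable_funB => //; exact: measurable_cst.
rewrite -(ge0_integral_law (Y := fun _ : unit => zeta 0 i 0)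
  (phi := fun z => (expR ((gs i x z - G i x) ^+ 2 / sigma ^+ 2))%:E) mz (i := tt) lawz mphi).
  rewrite le_eqVlt; apply/orP; left; apply/eqP; apply: eq_integral => w _.
  by rewrite /batch_value big_ord1 invr1 mul1r mulr1.
by move=> z; rewrite lee_fin expR_ge0.
Qed.

(** For [d = 0] the coordinate [j] ranges over an empty type, but then 0 is the only vector. *)
Lemma joint_measurable_values {R : realType} {d n : nat} {dX : measure_display}
  {X : measurableType dX} (gs : 'I_n -> 'rV[R]_d -> X -> R) :
  (forall i x, measurable_fun setT (gs i x)) ->
  (forall i (j : 'I_d), measurable_fun setT (fun p : VecM R d * X => gs i p.1 p.2)) ->
  forall i, measurable_fun setT (fun p : VecM R d * X => gs i p.1 p.2).
Proof.
case: d gs => [|d] gs mgs H i; last exact: H ord0.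
rewrite (_ : (fun p => _) = gs i 0 \o snd); last first.
  by apply/funext => p /=; rewrite (thinmx0 p.1).
exact: (measurableT_comp (mgs i 0) measurable_snd).
Qed.

Theorem theorem3 (R : realType) :
  exists kappa : R, 0 < kappa /\
  forall (d n : nat) (M Rad delta sigma beta : R) (T : nat),
    (0 < n)%N -> (0 < T)%N ->
    0 <= M -> 0 < delta <= 1 -> 0 < sigma -> 0 < beta < 2^-1 ->
  exists (gamma c : R) (Nfv : nat),
    0 < gamma /\ 0 < c /\ (0 < Nfv)%N /\
    (* batch size of order sigma^2/(n c^2) up to logarithmic factors *)
    Nfv%:R <= kappa * (sigma ^+ 2 / (n%:R * c ^+ 2)) * (1 + ln (T%:R / beta)) + 1 /\
  forall (dX : measure_display) (X : measurableType dX)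
         (D : 'I_n -> probability X R)
         (fs gs : 'I_n -> 'rV[R]_d -> X -> R)
         (fsub gsub : 'I_n -> 'rV[R]_d -> X -> 'rV[R]_d)
         (F G : 'I_n -> 'rV[R]_d -> R)
         (C : 'I_n -> 'rV[R]_d -> 'rV[R]_d)
         (x0 xstar : 'rV[R]_d)
         (dO : measure_display) (O : measurableType dO) (P : probability O R)
         (xi : nat -> 'I_n -> O -> X) (zeta : nat -> 'I_n -> nat -> O -> X),
    (* f_i(x) = E_{xi ~ D_i} f_i(x, xi), g_i(x) = E_{xi ~ D_i} g_i(x, xi) *)
    (forall i x, measurable_fun setT (fs i x) /\ measurable_fun setT (gs i x)) ->
    (forall i x, (D i).-integrable setT (fun w => (fs i x w)%:E) /\
                 (D i).-integrable setT (fun w => (gs i x w)%:E)) ->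
    (forall i x, (F i x)%:E = (\int[D i]_w (fs i x w)%:E)%E) ->
    (forall i x, (G i x)%:E = (\int[D i]_w (gs i x w)%:E)%E) ->
    (* convexity of f_i(., xi), g_i(., xi) *)
    (forall i w, convex_fun (fun x => fs i x w) /\ convex_fun (fun x => gs i x w)) ->
    (* stochastic subgradients: in the subdifferential, bounded by M, unbiased *)
    (forall i x w, is_subgrad (fun y => fs i y w) x (fsub i x w) /\
                   is_subgrad (fun y => gs i y w) x (gsub i x w)) ->
    (forall i x w, enorm (fsub i x w) <= M /\ enorm (gsub i x w) <= M) ->
    (forall i x, is_subgrad (F i) x (vmean (D i) (fsub i x)) /\
                 is_subgrad (G i) x (vmean (D i) (gsub i x))) ->
    (* measurability (regularity) of the oracles and compressors *)
    (forall i (j : 'I_d),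
        measurable_fun setT (fun p : VecM R d * X => vcoord j (fsub i p.1 p.2)) /\
        measurable_fun setT (fun p : VecM R d * X => vcoord j (gsub i p.1 p.2)) /\
        measurable_fun setT (fun p : VecM R d * X => gs i p.1 p.2) /\
        measurable_fun setT (fun v : VecM R d => vcoord j (C i v))) ->
    (* deterministic delta-contractive compressors *)
    (forall i, contractive delta (C i)) ->
    (* x* is an optimal solution of min f s.t. g <= 0 *)
    (n%:R^-1 * \sum_(i < n) G i xstar <= 0) ->
    (forall x, n%:R^-1 * \sum_(i < n) G i x <= 0 ->
       n%:R^-1 * \sum_(i < n) F i xstar <= n%:R^-1 * \sum_(i < n) F i x) ->
    enorm (x0 - xstar) <= Rad ->
    (* the samples: each with law D_i, all mutually independent *)
    (forall t i, measurable_fun setT (xi t i) /\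
       forall A, measurable A -> P (xi t i @^-1` A) = D i A) ->
    (forall t i k, measurable_fun setT (zeta t i k) /\
       forall A, measurable A -> P (zeta t i k @^-1` A) = D i A) ->
    mutually_independent P
      (fun s : (nat * 'I_n) + (nat * 'I_n * nat) =>
         match s with
         | inl (t, i) => xi t i
         | inr (t, i, k) => zeta t i k
         end) ->
    (* sub-Gaussian mini-batch constraint values, for every batch size N *)
    (forall (N t : nat) i x, (0 < N)%N ->
       (\int[P]_w (expR ((batch_value gs zeta N t i x w - G i x) ^+ 2
                         / (sigma ^+ 2 / N%:R)))%:E <= (expR 1)%:E)%E) ->
    let ghat := fun w t x => n%:R^-1 * \sum_(i < n) batch_value gs zeta Nfv t i x w in
    let fo := fun w t i x => fsub i x (xi t i w) in
    let go := fun w t i x => gsub i x (xi t i w) in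
    let bound := kappa * (M * Rad + sigma / Num.sqrt Nfv%:R) * (1 + ln (beta^-1))
                 / Num.sqrt (delta * T%:R) in
    exists E : set O, measurable E /\ ((1 - 2 * beta)%:E <= P E)%E /\
      forall w, E w ->
        let B := safe_ef_B gamma c x0 C (ghat w) (fo w) (go w) T in
        let xbar := safe_ef_xbar gamma c x0 C (ghat w) (fo w) (go w) T in
        (0 < size B)%N /\
        n%:R^-1 * \sum_(i < n) F i xbar - n%:R^-1 * \sum_(i < n) F i xstar <= bound /\
        n%:R^-1 * \sum_(i < n) G i xbar <= bound.
Proof.
pose K : R := 65 * 80 + 10.
have KE : K = 65 * 80 + 10 by [].
clearbody K.
have K0 : 0 < K by rewrite KE; lra.
(* It must dominate [K + 2], from the bound [c + eps] on the constraint, and [24 * (K + 1) ^+ 2],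
   from rewriting the batch size in terms of [c = (K + 1) * eps]. *)
exists (24 * (K + 2) ^+ 2); split; first by rewrite mulr_gt0// exprn_gt0// addr_gt0.
set kappa := 24 * _.
have kappaK : K + 2 <= kappa.
  by rewrite /kappa expr2; nra.
have kappaK2 : 24 * (K + 1) ^+ 2 <= kappa.
  by rewrite /kappa ler_pM2l// ler_sqr ?nnegrE; lra.
have kappa0 : 0 < kappa by lra.
clearbody kappa.
move=> d n M Rad delta sigma beta T n0 T0 M0 delta01 sigma0 /andP[beta0 beta1].
have nR : (0 : R) < n%:R by rewrite ltr0n.
have TR : (0 : R) < T%:R by rewrite ltr0n.
have /andP[delta0 delta1] := delta01.
pose l := 1 + ln (beta^-1).
have lnb0 : 0 <= ln (beta^-1).
  by rewrite ln_ge0// invf_ge1//; lra.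
have l1 : 1 <= l by rewrite /l; lra.
have l0 : 0 < l by lra.
have ln2 : ln 2 <= 1 :> R := ln2_le1.
have blE : - ln (beta / 2) <= l.
  have -> : - ln (beta / 2) = ln 2 + ln (beta^-1).
    rewrite -lnV ?posrE ?divr_gt0// invf_div lnM ?posrE ?invr_gt0//.
  by rewrite /l lerD2r.
pose sd := Num.sqrt (delta * T%:R).
have sd0 : 0 < sd by rewrite sqrtr_gt0 mulr_gt0.
have sd2 : sd ^+ 2 = delta * T%:R by rewrite sqr_sqrtr// mulr_ge0// ltW.
have [MR|MR] := ltP 0 (M * Rad).
  have Mp : 0 < M.
    by rewrite lt_neqAle M0 andbT; apply: contraTneq MR => <-; rewrite mul0r ltxx.
  have Rp : 0 < Rad by rewrite pmulr_rgt0 in MR.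
  (* These values give [step_cost = Rad ^+ 2 / T] and [gamma * eps = l * step_cost], the two
     balances on which the potentials rest. *)
  pose gamma := Rad * delta / (M * sd).
  pose eps := l * (M * Rad) / sd.
  pose c := (K + 1) * eps.
  have gamma0 : 0 < gamma by rewrite /gamma divr_gt0// mulr_gt0.
  have eps0 : 0 < eps by rewrite /eps divr_gt0// mulr_gt0.
  have c0 : 0 < c by rewrite /c mulr_gt0// addr_gt0.
  (* Real batch size at which the union bound over the iterations equals [beta]; rounding it up
     accounts for the additive 1 in the batch size. *)
  pose y := 24 * sigma ^+ 2 / (n%:R * eps ^+ 2) * ln (2 * T%:R / beta).
  have lnT : ln (2 * T%:R / beta) = ln 2 + ln (T%:R / beta).
    by rewrite -mulrA lnM ?posrE// divr_gt0.
  have T1 : (1 : R) <= T%:R by rewrite ler1n.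
  have lnT0 : 0 <= ln (T%:R / beta).
    by rewrite ln_ge0// ler_pdivlMr// mul1r; lra.
  have ln20 : 0 <= ln (2 : R) by rewrite ln_ge0//; lra.
  have fac0 : 0 < 24 * sigma ^+ 2 / (n%:R * eps ^+ 2).
    by apply: divr_gt0; apply: mulr_gt0 => //; rewrite exprn_gt0.
  have lnT1 : 0 <= ln (2 * T%:R / beta) by rewrite lnT; lra.
  have y0 : 0 <= y by rewrite /y; apply: mulr_ge0 => //; exact: ltW.
  pose Nfv := (Num.truncn y).+1.
  have /andP[Nle Nlt] := truncn_itv y0.
  have NR : (0 : R) < Nfv%:R by rewrite ltr0n.
  exists gamma, c, Nfv; split => //; split => //; split => //; split.
    rewrite /Nfv -natr1 lerD2r; apply: (le_trans Nle).
    have -> : y = 24 * (K + 1) ^+ 2 * (sigma ^+ 2 / (n%:R * c ^+ 2)) * ln (2 * T%:R / beta).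
      by rewrite /y /c; field; rewrite !gt_eqF//; lra.
    apply: ler_pM; last by rewrite lnT lerD2r.
    - apply: mulr_ge0; first by apply: mulr_ge0 => //; exact: sqr_ge0.
      by apply: divr_ge0; [exact: sqr_ge0|apply: mulr_ge0; [exact: ltW|exact: sqr_ge0]].
    - exact: lnT1.
    - apply: ler_wpM2r => //; apply: divr_ge0; first exact: sqr_ge0.
      by apply: mulr_ge0; [exact: ltW|exact: sqr_ge0].
  move=> dX X D fs gs fsub gsub F G C x0 xstar dO O P xi zeta.
  move=> meas integ Fmean Gmean _ _ subM subE oracle contr feas _ close xi_law zeta_law indep batch.
  move=> ghat fo go bound.
  have mgs i x : measurable_fun setT (gs i x) by have [] := meas i x.
  have gm i x : has_mean (D i) (gs i x) (G i x) by split; [case: (integ i x)|rewrite Gmean].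
  have mgsj := joint_measurable_values mgs (fun i j => (oracle i j).2.2.1).
  have gsg := batch_subgauss mgs zeta_law batch.
  have eps_le_c : eps <= c by rewrite /c; nra.
  have r20 : 0 < Rad ^+ 2 by rewrite exprn_gt0.
  have w0 : 0 < 256 * Rad ^+ 2 by lra.
  have laE : (80 * Rad ^+ 2)^-1 * (80 * Rad ^+ 2) = 1 by rewrite mulVf// gt_eqF//; lra.
  have la0 : 0 < (80 * Rad ^+ 2)^-1 by rewrite invr_gt0; lra.
  have stepE : step_cost M delta gamma = Rad ^+ 2 / T%:R.
    have -> : step_cost M delta gamma = Rad ^+ 2 * delta / sd ^+ 2.
      by rewrite /step_cost /gamma; field; rewrite !gt_eqF.
    by rewrite sd2; field; rewrite !gt_eqF.
  have geE : gamma * eps = l * step_cost M delta gamma.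
    rewrite stepE; have -> : gamma * eps = l * (Rad ^+ 2 * delta / sd ^+ 2).
      by rewrite /gamma /eps; field; rewrite !gt_eqF.
    by rewrite sd2; field; rewrite !gt_eqF.
  have close2 : enorm (x0 - xstar) ^+ 2 <= Rad ^+ 2 by rewrite ler_sqr ?nnegrE ?enorm_ge0// ltW.
  have tail : 2 * T%:R * expR (- (n%:R * Nfv%:R * eps ^+ 2 / (24 * sigma ^+ 2))) <= beta.
    have -> : beta = 2 * T%:R * expR (- ln (2 * T%:R / beta)).
      rewrite -lnV ?posrE ?divr_gt0 ?mulr_gt0// lnK ?posrE ?invr_gt0 ?divr_gt0 ?mulr_gt0//.
      by field; rewrite !gt_eqF.
    rewrite ler_pM2l ?mulr_gt0// ler_expR lerN2.
    have -> : ln (2 * T%:R / beta) = n%:R * y * eps ^+ 2 / (24 * sigma ^+ 2).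
      by rewrite /y; field; rewrite !gt_eqF// ?exprn_gt0.
    rewrite ler_pM2r ?invr_gt0 ?mulr_gt0 ?exprn_gt0// ler_pM2r ?exprn_gt0// ler_pM2l//.
    exact: ltW.
  have boundE : (K + 2) * eps <= bound.
    have -> : bound = kappa * ((M * Rad + sigma / Num.sqrt Nfv%:R) * l / sd).
      by rewrite /bound -/l -/sd; ring.
    apply: (@le_trans _ _ (kappa * eps)); first by rewrite ler_pM2r.
    rewrite ler_pM2l// /eps ler_pM2r ?invr_gt0// mulrC ler_pM2r// lerDl.
    by rewrite divr_ge0 ?sqrtr_ge0// ltW.
  have [E [mE PE HE]] := high_probability n0 xi_law zeta_law indep oracle mgsj subM subE contr
    delta01 M0 gamma0 eps0 eps_le_c T0 r20 l1 w0 erefl la0 laE erefl stepE geE feas close2 KE erefl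
    sigma0 (isT : (0 < Nfv)%N) gm gsg beta0 blE tail.
  exists E; split => //; split => // w /HE[B0 Hf Hg]; split; first exact: B0.
  split; first by apply: (le_trans Hf); apply: le_trans boundE; rewrite ler_pM2r//; lra.
  apply: (le_trans Hg); apply: le_trans boundE; rewrite /c.
  by rewrite le_eqVlt; apply/orP; left; apply/eqP; ring.
(* Here [M * Rad <= 0]. The number [b0] is the part of the bound due to [sigma] for batch size 1,
   and [gamma] is made so small that the trajectory moves within it; [h + 1] avoids a division by
   zero when [M = 0]. *)
pose b0 := kappa * sigma * l / sd.
have b00 : 0 < b0 by rewrite /b0 divr_gt0// !mulr_gt0.
pose h := M ^+ 2 * (T%:R + 2 / delta).
have h0 : 0 <= h.
  by rewrite /h mulr_ge0 ?sqr_ge0// addr_ge0 ?(ltW TR)// divr_ge0// ltW.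
pose gamma := b0 / (h + 1).
(* The Chernoff exponent for batch size 1 becomes [n * l], and [expR (- l) <= beta]. *)
pose c := Num.sqrt (24 * sigma ^+ 2 * l).
have s20 : 0 < sigma ^+ 2 by rewrite exprn_gt0.
have c2 : c ^+ 2 = 24 * sigma ^+ 2 * l.
  by rewrite sqr_sqrtr// mulr_ge0 ?(ltW l0)// mulr_ge0// ltW.
have c0 : 0 < c by rewrite sqrtr_gt0 !mulr_gt0.
have gamma0 : 0 < gamma by rewrite /gamma divr_gt0//; lra.
exists gamma, c, 1%N; split => //; split => //; split => //; split.
  rewrite lerDr mulr_ge0//.
    by rewrite mulr_ge0 ?(ltW kappa0)// divr_ge0 ?(ltW s20)// mulr_ge0 ?sqr_ge0// ltW.
  rewrite addr_ge0// ln_ge0// ler_pdivlMr// mul1r.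
  by have : (1 : R) <= T%:R; [rewrite ler1n|lra].
move=> dX X D fs gs fsub gsub F G C x0 xstar dO O P xi zeta.
move=> meas integ Fmean Gmean _ _ subM subE oracle contr feas _ close xi_law zeta_law indep batch.
move=> ghat fo go bound.
have mgs i x : measurable_fun setT (gs i x) by have [] := meas i x.
have gm i x : has_mean (D i) (gs i x) (G i x) by split; [case: (integ i x)|rewrite Gmean].
have mgsj := joint_measurable_values mgs (fun i j => (oracle i j).2.2.1).
have gsg := batch_subgauss mgs zeta_law batch.
have Rad0 : 0 <= Rad := le_trans (enorm_ge0 _) close.
have boundE : gamma * M ^+ 2 * (T%:R + 2 / delta) <= bound.
  apply: (@le_trans _ _ b0).
    rewrite -mulrA -/h /gamma mulrAC ler_pdivrMr; last lra.
    by rewrite ler_pM2l//; lra.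
  rewrite /bound -/l -/sd sqrtr1 divr1 /b0 ler_pM2r ?invr_gt0// ler_pM2r// ler_pM2l//.
  by rewrite lerDr mulr_ge0.
have tail : 2 * expR (- (n%:R * 1%:R * c ^+ 2 / (24 * sigma ^+ 2))) <= 2 * beta.
  rewrite ler_pM2l// -[leRHS]lnK ?posrE// ler_expR c2.
  have -> : n%:R * 1%:R * (24 * sigma ^+ 2 * l) / (24 * sigma ^+ 2) = n%:R * l.
    by field; rewrite gt_eqF.
  rewrite -[ln beta]opprK -lnV ?posrE// lerN2.
  have n1 : (1 : R) <= n%:R by rewrite ler1n.
  by rewrite /l in l0 *; nra.
have [E [mE PE HE]] := degenerate_high_probability n0 xi_law zeta_law indep oracle mgsj subM subE
  contr delta01 M0 gamma0 sigma0 (isT : (0 < 1)%N) T0 gm gsg c0 tail feas close MR boundE.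
by exists E; split => //; split => // w /HE[B0 Hf Hg].
Qed.
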